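(* Let $(F_j)_{j=0}^\infty$ be a JTG family with associated set $\mathcal F_2$ and space $JT_{\mathcal F_2}$. Let $(x_n)_n$ be a weakly null separated sequence in $JT_{\mathcal F_2}$ with $\|x_n\|_{\mathcal F_2}\le C$ for all $n$. Then for all $m\in\mathbb N$ there is an infinite $L\subset\mathbb N$ such that for every $y^*\in\mathcal F_2$, $$\#\Big\{n\in L:\ |y^*(x_n)|\ge\frac1m\Big\}\le66\,m^2C^2.$$
   Context: $c_{00}(\mathbb N)$ is the space of finitely supported real sequences with unit vectors $(e_n)$; $e_n^*$ is the same unit vector regarded as a functional; $f\in c_{00}(\mathbb N)$ acts by $f(x)=\sum_nf(n)x(n)$; $Ef$ is the restriction of $f$ to an interval $E$; $f<g$ means $\max\operatorname{supp}f<\min\operatorname{supp}g$, and a block sequence is one with successive supports. A James Tree Generating (JTG) family is a sequence $(F_j)_{j=0}^\infty$ of subsets of $c_{00}(\mathbb N)$ such that: (A) $F_0=\{\pm e_n^*:n\in\mathbb N\}$ and each $F_j$ is nonempty, countable, symmetric, compact in the topology of pointwise convergence and closed under restrictions to intervals of $\mathbb N$; (B) setting $\tau_j=\sup\{\|f\|_\infty:f\in F_j\}$, the sequence $(\tau_j)_{j\in\mathbb N}$ is strictly decreasing and $\sum_{j=1}^\infty\tau_j\le1$. Fix disjoint infinite $\Xi_1,\Xi_2\subset\mathbb N$ and an injective $\sigma_{\mathcal F}$ from the set of finite sequences $(f_1<\dots<f_d)$ in $\bigcup_{j\ge1}F_j\setminus\{0\}$ into $\Xi_2$ with $\sigma_{\mathcal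 F}(f_1,\dots,f_d)>\max\{k:\exists i,\ f_i\in F_k\}$. A finite or infinite block sequence $s=(f_i)_i$ in $\bigcup_{j\ge1}F_j\setminus\{0\}$ is $\sigma_{\mathcal F}$ special if $f_1\in\bigcup_{l\in\Xi_1}F_l$ and $f_{i+1}\in F_{\sigma_{\mathcal F}(f_1,\dots,f_i)}$ for all $i$; $\operatorname{ind}_s(f_1)=\min\{j:f_1\in F_j\}$, $\operatorname{ind}_s(f_i)=\sigma_{\mathcal F}(f_1,\dots,f_{i-1})$ for $i\ge2$. A finite $\sigma_{\mathcal F}$ special functional is $x^*=E\sum_if_i$ with $s=(f_i)_i$ special and $E$ a finite interval; $\operatorname{ind}_s(x^* )=\{\operatorname{ind}_s(f_i):Ef_i\ne0\}$. A family $(x_k^* )_k$ of such functionals is disjoint if representing special sequences $s_k$ and intervals $E_k$ can be chosen so that the sets $\operatorname{ind}_{s_k}(x_k^* )$ are pairwise disjoint. $\mathcal F_2=F_0\cup\{\sum_{k=1}^da_kx_k^*:a_k\in\mathbb Q,\ \sum_{k=1}^da_k^2\le1,\ (x_k^* )_{k=1}^d$ a disjoint family of finite $\sigma_{\mathcal F}$ special functionals$\}$, and $JT_{\mathcal F_2}$ is the completion of $c_{00}(\mathbb N)$ under $\|x\|_{\mathcal F_2}=\sup\{f(x):f\in\mathcal F_2\}$. A bounded block sequence $(x_n)_n$ in $JT_{\mathcal F_2}$ is $\varepsilon$-separated (with respect to an infinite index set) if $\#\{n:|\phi(x_n)|\ge\varepsilon\}\le1$ for every $\phi\in\bigcup_{j\in\mathbb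 N}F_j$ ($j\ge1$). It is separated if for every infinite $L\subset\mathbb N$ and every $\varepsilon>0$ there is an infinite $M\subset L$ such that $(x_n)_{n\in M}$ is $\varepsilon$-separated. *)

(* Defs.v *)
From HB Require Import structures.
From mathcomp Require Import all_boot all_order all_algebra.
From mathcomp Require Import finmap.
From mathcomp Require Import all_classical all_reals all_analysis.

Set Implicit Arguments.
Unset Strict Implicit.
Unset Printing Implicit Defensive.

Import Order.TTheory GRing.Theory Num.Theory.
Import numFieldNormedType.Exports.

Local Open Scope classical_set_scope.
Local Open Scope ring_scope.

(* Coordinates are indexed by nat, i.e. from 0; the families F_j, the sets
   Xi_1, Xi_2 and the codes sigma(f_1, ..., f_d) keep their original numbering,
   so that "j in N" reads "0 < j" there. *)

Section c00_def.
Context {R : realType}.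

Definition supp (f : nat -> R) : set nat := [set n | f n != 0].

Definition fin_supp : {pred (nat -> R)} := mem [set f | finite_set (supp f)].

Lemma fin_suppE (f : nat -> R) : (f \in fin_supp) = `[< finite_set (supp f) >].
Proof. by []. Qed.

Lemma fin_supp_submod_closed : submod_closed fin_supp.
Proof.
split=> [|a f g]; rewrite !fin_suppE.
  apply/asboolP; suff -> : supp 0 = set0 by exact: finite_set0.
  by rewrite predeqE => n; split=> //=; rewrite /supp /= eqxx.
move=> /asboolP ff /asboolP fg; apply/asboolP.
apply: (@sub_finite_set _ _ (supp f `|` supp g)); last by rewrite finite_setU.
move=> n /=; rewrite /supp /= => afg.
have [f0|] := eqVneq (f n) 0; last by left.
right; apply: contraNneq afg => g0.
change (a * f n + g n == 0).
by rewrite f0 g0 mulr0 addr0.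
Qed.

HB.instance Definition _ :=
  GRing.isSubmodClosed.Build R (nat -> R) fin_supp fin_supp_submod_closed.

End c00_def.

Record c00 (R : realType) := C00 {
  c00_fun :> nat -> R;
  _ : c00_fun \in fin_supp }.

HB.instance Definition _ (R : realType) := [isSub of c00 R for @c00_fun R].
HB.instance Definition _ (R : realType) := [Choice of c00 R by <:].
HB.instance Definition _ (R : realType) :=
  [SubChoice_isSubLmodule of c00 R by <:].

Section JT_space.
Context {R : realType}.
Implicit Types (f g x : c00 R) (E I L M : set nat) (s : nat -> c00 R).

Lemma restr_subproof E f : (fun n => if n \in E then f n else 0) \in fin_supp.
Proof.
rewrite fin_suppE; apply/asboolP; apply: (@sub_finite_set _ _ (supp f)).
  by move=> n; rewrite /supp /=; case: (n \in E); rewrite ?eqxx.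
by case: f => f /=; rewrite fin_suppE => /asboolP.
Qed.

Definition restr E f : c00 R := C00 (restr_subproof E f).

Lemma unit_vec_subproof n : (fun k => (k == n)%:R : R) \in fin_supp.
Proof.
rewrite fin_suppE; apply/asboolP; apply: (@sub_finite_set _ _ [set n]) => // k.
by rewrite /supp /=; case: (eqVneq k n) => //; rewrite eqxx.
Qed.

Definition unit_vec n : c00 R := C00 (unit_vec_subproof n).

Definition pairing f x : R := \sum_(n \in [set: nat]) f n * x n.

Definition supnorm f : R := \big[Order.max/0]_(n <- fset_set (supp f)) `|f n|.

Definition nat_interval E :=
  forall a b, E a -> E b -> forall n, (a <= n <= b)%N -> E n.

Definition successive f g :=
  [/\ f != 0, g != 0 &
      forall i j, supp f i -> supp g j -> (i < j)%N].

Definition block_sequence (x : nat -> c00 R) := forall n, successive (x n) (x n.+1).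

Definition tau (F : nat -> set (c00 R)) (j : nat) : \bar R :=
  ereal_sup [set (supnorm f)%:E | f in F j].

Record JTG_family (F : nat -> set (c00 R)) : Prop := {
  JTG_0 : F 0%N = [set f | exists n, f = unit_vec n \/ f = - unit_vec n];
  (* For j = 0 compactness and closure under restrictions would require
     0 \in F 0, so these properties are about j >= 1 only. *)
  JTG_nonempty : forall j, (0 < j)%N -> F j !=set0;
  JTG_countable : forall j, (0 < j)%N -> countable (F j);
  JTG_symmetric : forall j, (0 < j)%N -> forall f, F j f -> F j (- f);
  JTG_compact : forall j, (0 < j)%N ->
    compact ((@c00_fun R @` F j) : set {ptws nat -> R});
  JTG_restr : forall j, (0 < j)%N ->
    forall f E, nat_interval E -> F j f -> F j (restr E f);
  JTG_tau_decr : forall i j, (0 < i)%N -> (i < j)%N -> (tau F j < tau F i)%E;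
  JTG_tau_sum : (\sum_(1 <= j <oo) tau F j <= 1)%E }.

Definition Fpos (F : nat -> set (c00 R)) : set (c00 R) :=
  [set f | exists2 j, (0 < j)%N & F j f].

Definition coding_domain (F : nat -> set (c00 R)) : set (seq (c00 R)) :=
  [set t | [/\ (0 < size t)%N,
     forall f, f \in t -> Fpos F f /\ f != 0 &
     forall i, (i.+1 < size t)%N -> successive t`_i t`_i.+1]].

Record coding (F : nat -> set (c00 R)) (Xi1 Xi2 : set nat)
    (sigma : seq (c00 R) -> nat) : Prop := {
  coding_Xi1_pos : forall j, Xi1 j -> (0 < j)%N;
  coding_Xi2_pos : forall j, Xi2 j -> (0 < j)%N;
  coding_Xi1_inf : infinite_set Xi1;
  coding_Xi2_inf : infinite_set Xi2;
  coding_disj : Xi1 `&` Xi2 = set0;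
  coding_inj : set_inj (coding_domain F) sigma;
  coding_range : forall t, coding_domain F t -> Xi2 (sigma t);
  coding_gt : forall t, coding_domain F t ->
    forall f k, f \in t -> F k f -> (k < sigma t)%N }.

(* A nonempty finite or infinite sequence (f_1, f_2, ...) is given by
   s : nat -> c00 R, with s i = f_(i+1), and its index set I; the values of s
   outside I are irrelevant. *)
Definition index_set I := I = setT \/ exists d, I = [set i | (i <= d)%N].

Section special.
Variables (F : nat -> set (c00 R)) (Xi1 : set nat) (sigma : seq (c00 R) -> nat).

Definition special_seq I s :=
  [/\ index_set I,
      forall i, I i -> Fpos F (s i) /\ s i != 0,
      forall i, I i.+1 -> successive (s i) (s i.+1),
      exists2 l, Xi1 l & F l (s 0%N) &
      forall i, I i.+1 -> F (sigma (mkseq s i.+1)) (s i.+1)].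

Definition ind_seq s (i : nat) : nat :=
  if i is 0 then
    xget 0%N [set j | F j (s 0%N) /\ forall k, F k (s 0%N) -> (j <= k)%N]
  else sigma (mkseq s i).

Definition special_functional I s E f :=
  [/\ special_seq I s, nat_interval E, finite_set E &
      forall n, f n = if n \in E then \sum_(i \in I) s i n else 0].

Definition ind_functional I s E : set nat :=
  [set ind_seq s i | i in [set i | I i /\ restr E (s i) != 0]].

Definition disjoint_family (d : nat) (f : 'I_d -> c00 R) :=
  exists (I : 'I_d -> set nat) (s : 'I_d -> nat -> c00 R) (E : 'I_d -> set nat),
    (forall k, special_functional (I k) (s k) (E k) (f k)) /\
    trivIset setT (fun k => ind_functional (I k) (s k) (E k)).

Definition F2 : set (c00 R) :=
  F 0%N `|`
  [set f | exists (d : nat) (a : 'I_d -> rat) (g : 'I_d -> c00 R),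
     [/\ (0 < d)%N, \sum_k a k ^+ 2 <= 1, disjoint_family g &
         f = \sum_k ratr (a k) *: g k]].

Definition JT_norm x : \bar R := ereal_sup [set (pairing f x)%:E | f in F2].

(* The completion of (c00 R, JT_norm), characterized up to isometric
   isomorphism: a Banach space with an isometric dense copy of c00 R. *)
Definition JT_completion (X : completeNormedModType R)
    (iota : {linear c00 R -> X}) : Prop :=
  (forall x, (`|iota x|)%:E = JT_norm x) /\ dense (range iota).

Definition eps_separated M (eps : R) (x : nat -> c00 R) :=
  forall f, Fpos F f ->
    is_subset1 [set n | M n /\ eps <= `|pairing f (x n)|].

Definition separated_seq (x : nat -> c00 R) :=
  [/\ exists K : R, forall n, (JT_norm (x n) <= K%:E)%E,
      block_sequence x &
      forall L (eps : R), infinite_set L -> 0 < eps ->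
        exists M, [/\ M `<=` L, infinite_set M & eps_separated M eps x]].

End special.

Definition weakly_null (X : normedModType R) (u : nat -> X) :=
  forall phi : {linear X -> R^o}, continuous phi -> phi (u n) @[n --> \oo] --> (0 : R).

End JT_space.

(* Main.v *)
(* Two special sequences sharing an index sigma(...) share their past, and for
   fixed n' fewer than K^2 (K > C/eps) special functionals with disjoint indices
   are >= eps on x_n'. Hence fewer than K^2 functionals account for all n < n'
   such that some special functional is >= eps on both x_n and x_n'. Letting n'
   run along a free ultrafilter, these converge to bounded functionals, along
   which (x_n) is null; so there is an infinite set without such pairs (n, n'),
   and on it a special functional is >= eps at most four times (four, not one,
   because of elements and intervals that straddle several x_n).
   Diagonalize over eps_n decreasing fast with the tails of sum tau_j. Then each
   x_k^* in sum_k a_k x_k^* matters on at most five x_n. On a given x_n, the k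
   that matter contribute at most C (sum a_k^2)^(1/2), the sum being over these
   k, and all others together at most 1/(2m). Summing squares over n gives the
   bound 20 m^2 C^2. *)
From HB Require Import structures.
Require Import Defs.
From mathcomp Require Import all_boot all_order all_algebra.
From mathcomp Require Import finmap.
From mathcomp Require Import all_classical all_reals all_analysis.
From mathcomp Require Import ring lra zify.
Import Order.TTheory GRing.Theory Num.Theory.
Import numFieldNormedType.Exports.
Local Open Scope classical_set_scope.
Local Open Scope ring_scope.

Set Implicit Arguments.
Unset Strict Implicit.
Unset Printing Implicit Defensive.

(** * Infinite sets and selections *)
Section Choices.

Lemma unbounded_infinite (L : set nat) :
  (forall N, exists n, (N <= n)%N /\ L n) -> infinite_set L.
Proof.
move=> H /finite_fsetP[A LA].
have [n []] := H (\max_(i <- A) i).+1.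
by rewrite LA /= => + nA; rewrite ltnNge (leq_bigmax_seq (F := fun i => i) n).
Qed.

Lemma infinite_unbounded (L : set nat) (N : nat) :
  infinite_set L -> exists n, (N <= n)%N /\ L n.
Proof.
move=> iL; apply: contrapT => H; apply: iL.
apply: (sub_finite_set _ (finite_II N)) => n Ln /=.
by rewrite ltnNge; apply/negP => Nn; apply: H; exists n.
Qed.

(** Greedy selection: each new element is chosen against the finite list [u k] of all earlier ones.
    It serves both to avoid linked pairs and to diagonalize over a decreasing sequence of sets. *)
Lemma diagonal_subset (P : set nat) (D : nat -> set nat) :
  (forall t : seq nat, (forall i, i \in t -> P i) ->
     exists n, P n /\ forall i, i \in t -> (i < n)%N /\ D i n) ->
  exists L, [/\ L `<=` P, infinite_set L &
    forall i j, L i -> L j -> (i < j)%N -> D i j].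
Proof.
move=> H.
have /choice[nxt nxtP] : forall t : seq nat, exists n,
    (forall i, i \in t -> P i) ->
    P n /\ forall i, i \in t -> (i < n)%N /\ D i n.
  move=> t; have [Pt|nPt] := pselect (forall i, i \in t -> P i).
    by have [n Hn] := H t Pt; exists n.
  by exists 0%N.
pose u := fix u k := if k is k'.+1 then nxt (u k') :: u k' else [::].
pose v k := nxt (u k).
have uP k i : i \in u k -> P i.
  elim: k i => [//|k IH] i; rewrite /= inE => /orP[/eqP ->|]; last exact: IH.
  by have [] := nxtP _ IH.
have vu k l : (k < l)%N -> v k \in u l.
  elim: l => [//|l IH]; rewrite ltnS leq_eqVlt => /orP[/eqP ->|kl] /=.
    by rewrite inE eqxx.
  by rewrite inE IH ?orbT.
have vD k l : (k < l)%N -> (v k < v l)%N /\ D (v k) (v l).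
  by move=> kl; have [_] := nxtP _ (uP l); apply; exact: vu.
have vlt k l : (v k < v l)%N -> (k < l)%N.
  move=> kl; rewrite ltnNge leq_eqVlt; apply/negP => /orP[/eqP e|/vD[lk _]].
    by rewrite e ltnn in kl.
  by rewrite ltnNge ltnW in kl.
exists (range v); split.
- by move=> _ [k _ <-]; have [] := nxtP _ (uP k).
- apply: unbounded_infinite => N; exists (v N); split; last by exists N.
  elim: N => [//|N NvN]; have [vN _] := vD _ _ (ltnSn N).
  exact: leq_ltn_trans NvN vN.
- by move=> _ _ [k _ <-] [l _ <-] /vlt/vD[].
Qed.

(** Take [r] such that independent families of length [r] exist but none of length [r + 1]:
    prolonging by [w] must fail, so [w] is related to a member, in one order or the other. *)
Lemma maximal_independent (T : Type) (t0 : T) (P : set T)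
    (R : T -> T -> Prop) (K : nat) :
  ~ (exists f : nat -> T, (forall i, (i < K)%N -> P (f i)) /\
      forall i j, (i < K)%N -> (j < K)%N -> i <> j -> ~ R (f i) (f j)) ->
  exists r (f : nat -> T), [/\ (r < K)%N, forall i, (i < r)%N -> P (f i) &
    forall w, P w -> exists i, (i < r)%N /\ (R w (f i) \/ R (f i) w)].
Proof.
pose Q r := exists f : nat -> T, (forall i, (i < r)%N -> P (f i)) /\
      forall i j, (i < r)%N -> (j < r)%N -> i <> j -> ~ R (f i) (f j).
move=> nQ.
have Q0 : Q 0%N by exists (fun=> t0).
have [r [rK [f [fP fR]] nQr]] : exists r, [/\ (r < K)%N, Q r & ~ Q r.+1].
  apply: contrapT => H; apply: nQ.
  have : forall r, (r <= K)%N -> Q r.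
    elim=> [//|r IH] rK; apply: contrapT => nQr; apply: H.
    by exists r; split => //; apply: IH; exact: ltnW.
  exact.
exists r, f; split => // w Pw; apply: contrapT => H; apply: nQr.
exists (fun i => if (i < r)%N then f i else w); split.
  by move=> i _; case: ifP => // /fP.
have nR i : (i < r)%N -> ~ R w (f i) /\ ~ R (f i) w.
  by move=> ir; split => Hr; apply: H; exists i; split => //; [left|right].
move=> i j; rewrite !ltnS => ir jr ij.
case: ifPn => [ir'|]; case: ifPn => [jr'|].
- exact: fR.
- by move=> _; have [] := nR _ ir'.
- by move=> _; have [] := nR _ jr'.
- by rewrite -!leqNgt => rj ri; case: ij; lia.
Qed.

(** The injective [p] turns the left side into a part of a nonnegative sum over [j <= i < N], with
    [N] beyond all [p k]. Applied to the bounds of the tau_j and to powers of 1/2. *)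
Lemma sumr_inj_le (R : realDomainType) (d : nat) (p : 'I_d -> nat)
    (Q : pred 'I_d) (c : nat -> R) (j : nat) (eta : R) :
  (forall i, 0 <= c i) ->
  (forall N, \sum_(j <= i < N) c i <= eta) ->
  (forall k l, Q k -> Q l -> p k = p l -> k = l) ->
  (forall k, Q k -> (j <= p k)%N) ->
  \sum_(k < d | Q k) c (p k) <= eta.
Proof.
move=> c0 ceta pinj pj.
pose N := (\max_(k < d) p k).+1.
apply: (le_trans _ (ceta N)).
set s := [seq p k | k <- enum 'I_d & Q k].
have -> : \sum_(k < d | Q k) c (p k) = \sum_(i <- s) c i.
  by rewrite big_map big_filter big_enum_cond.
have us : uniq s.
  rewrite map_inj_in_uniq; first exact/filter_uniq/enum_uniq.
  move=> k l; rewrite !mem_filter => /andP[Qk _] /andP[Ql _].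
  exact: pinj.
have -> : \sum_(j <= i < N) c i =
    \sum_(i <- [seq i <- index_iota j N | i \in s] ++
               [seq i <- index_iota j N | i \notin s]) c i.
  by apply: perm_big; rewrite perm_sym (permEl (perm_filterC (mem s) _)).
rewrite big_cat /=.
rewrite (perm_big [seq i <- index_iota j N | i \in s]) /=; last first.
  apply: uniq_perm => //; first by rewrite filter_uniq ?iota_uniq.
  move=> i; rewrite mem_filter mem_index_iota.
  apply/idP/andP => [is_|[]//]; split => //.
  move/mapP: is_ => [k]; rewrite mem_filter => /andP[Qk _] ->.
  by rewrite pj //= /N ltnS leq_bigmax.
by rewrite lerDl sumr_ge0.
Qed.

End Choices.

(** * The pairing on finitely supported sequences *)
Section Pairing.
Context {R : realType}.
Implicit Types (f g u v : c00 R).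

Lemma c00_linearE (a : R) f g w : (a *: f + g : c00 R) w = a * f w + g w.
Proof.
rewrite -[LHS]/((\val (a *: f + g) : nat -> R) w).
by rewrite GRing.valD GRing.valZ.
Qed.

Lemma c00_0E w : (0 : c00 R) w = 0.
Proof. by rewrite -[LHS]/((\val (0 : c00 R) : nat -> R) w) raddf0. Qed.

Lemma c00_neq0 f : f != 0 -> exists w, f w != 0.
Proof.
move=> f0; apply: contrapT => H; move/negP: f0; apply; apply/eqP/val_inj/funext => w.
suff : f w = (0 : c00 R) w by [].
by rewrite c00_0E; have [//|fw] := eqVneq (f w) 0; case: H; exists w.
Qed.

Lemma c00_bound u : exists N, forall n, (N <= n)%N -> u n = 0.
Proof.
case: u => u /= ; rewrite fin_suppE => /asboolP fu; apply: contrapT => H.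
apply: (unbounded_infinite _ fu) => N; apply: contrapT => HN; apply: H.
exists N => n Nn; have [//|un] := eqVneq (u n) 0.
by case: HN; exists n.
Qed.

Lemma pairing_big f u N : (forall n, (N <= n)%N -> u n = 0) ->
  pairing f u = \sum_(n < N) f n * u n.
Proof.
move=> uN; rewrite (fsbig_ord _ N (fun n => f n * u n)).
symmetry; apply: (fsbig_widen _ setT) => // n [_ /= nN].
by rewrite uN ?mulr0 // leqNgt; apply/negP.
Qed.

Lemma eq_pairing f g u : (forall n, u n != 0 -> f n = g n) ->
  pairing f u = pairing g u.
Proof.
move=> fg; apply: eq_fsbigr => n _.
by have [->|/fg ->//] := eqVneq (u n) 0; rewrite !mulr0.
Qed.

Lemma pairing0r u : pairing 0 u = 0.
Proof.
have [N uN] := c00_bound u.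
by rewrite (pairing_big _ uN) big1 // => i _; rewrite c00_0E mul0r.
Qed.

Lemma pairing_neq0 f u : pairing f u != 0 -> exists w, f w != 0 /\ u w != 0.
Proof.
move=> fu; apply: contrapT => H; move/negP: fu; apply; apply/eqP.
rewrite (@eq_pairing f 0 u) ?pairing0r // => n un; rewrite c00_0E.
by have [//|fn] := eqVneq (f n) 0; case: H; exists n.
Qed.

Lemma pairing_linearl (a : R) f g u :
  pairing (a *: f + g) u = a * pairing f u + pairing g u.
Proof.
have [N uN] := c00_bound u.
rewrite !(pairing_big _ uN) mulr_sumr -big_split; apply: eq_bigr => i _.
by rewrite c00_linearE mulrDl mulrA.
Qed.

Lemma pairing_linearr f (a : R) u v :
  pairing f (a *: u + v) = a * pairing f u + pairing f v.
Proof.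
have [N uN] := c00_bound u; have [M vM] := c00_bound v.
have uK n : (maxn N M <= n)%N -> u n = 0 by rewrite geq_max => /andP[/uN].
have vK n : (maxn N M <= n)%N -> v n = 0 by rewrite geq_max => /andP[_ /vM].
rewrite (pairing_big _ uK) (pairing_big _ vK) (@pairing_big _ _ (maxn N M)).
  rewrite mulr_sumr -big_split; apply: eq_bigr => i _.
  by rewrite c00_linearE mulrDr mulrCA.
by move=> n nK; rewrite c00_linearE uK // vK // mulr0 addr0.
Qed.

Lemma pairing_suml (I : Type) (r : seq I) (P : pred I) (a : I -> R)
    (g : I -> c00 R) u :
  pairing (\sum_(k <- r | P k) a k *: g k) u =
  \sum_(k <- r | P k) a k * pairing (g k) u.
Proof.
elim/big_rec2: _ => [|k y f _ <-]; first exact: pairing0r.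
exact: pairing_linearl.
Qed.

Lemma pairing_unit_vec n u : pairing (unit_vec n) u = u n.
Proof.
rewrite /pairing -(fsbig_widen [set n]) //; last first.
  move=> k [_ /= kn]; rewrite (_ : (k == n) = false) ?mul0r //.
  exact/negbTE/eqP.
by rewrite fsbig_set1 /= eqxx mul1r.
Qed.

Lemma restrE (E : set nat) f w : restr E f w = if w \in E then f w else 0.
Proof. by []. Qed.

End Pairing.

(** * Ultralimits of functionals *)
Section WeaklyNull.
Context {R : realType}.

(** The limit is the supremum of the levels [r] with [r <= f n] for [U]-many [n]; a higher level
    fails, and then the ultrafilter contains the complement. *)
Lemma ultra_limit (U : set_system nat) (f : nat -> R) (c : R) :
  UltraFilter U -> (forall n, `|f n| <= c) ->
  exists l, forall e, 0 < e -> U [set n | `|f n - l| < e].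
Proof.
move=> UU fc.
pose S := [set r | U [set n | r <= f n]].
have S0 : S (- c).
  rewrite /S /=; apply: filterS filterT => n _ /=.
  by have := fc n; rewrite ler_norml => /andP[].
have Sc : ubound S c.
  move=> r /filter_ex[n /= rf]; apply: (le_trans rf).
  by have := fc n; rewrite ler_norml => /andP[].
have supS : has_sup S by split; [exists (- c)|exists c].
exists (sup S) => e e0.
have [r Sr lr] := sup_adherent e0 supS.
have nS : U (~` [set n | sup S + e / 2 <= f n]).
  have [UA|//] := in_ultra_setVsetC [set n | sup S + e / 2 <= f n] UU.
  have : sup S + e / 2 <= sup S by apply: ub_le_sup => //; exists c.
  lra.
apply: filterS (filterI Sr nS) => n /= [rf /negP]; rewrite -ltNge => fl.
by rewrite ltr_norml; apply/andP; split; lra.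
Qed.

(* The extension is z |-> sup_v (b v - |z - iota v|). *)
Lemma dense_linear_extension (V : lmodType R) (X : normedModType R)
    (iota : {linear V -> X}) (b : V -> R) :
  dense (range iota) ->
  (forall a u v, b (a *: u + v) = a * b u + b v) ->
  (forall u, `|b u| <= `|iota u|) ->
  exists phi : {linear X -> R^o}, continuous phi /\ forall u, phi (iota u) = b u.
Proof.
move=> dX blin bN.
have bB u v : b (u - v) = b u - b v.
  by rewrite addrC -scaleN1r blin mulN1r addrC.
have bdiff u v z : b u - `|z - iota u| <= b v + `|z - iota v|.
  have : b u - b v <= `|iota u - iota v|.
    by rewrite -bB -raddfB; apply: le_trans (ler_norm _) (bN _).
  have := ler_distD z (iota u) (iota v); rewrite (distrC (iota u) z); lra.
pose S z := [set r | exists v, r = b v - `|z - iota v|].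
pose phi z := sup (S z).
(* Everything rests on this estimate: linearity follows by approximation from the dense range, the
   norm bound from [v = 0], the extension property from [z = iota v]. *)
have phiP z v : `|phi z - b v| <= `|z - iota v|.
  have supS : has_sup (S z).
    split; first by exists (b 0 - `|z - iota 0|); exists 0.
    by exists (b v + `|z - iota v|) => _ [u ->].
  have : phi z <= b v + `|z - iota v|.
    by apply: ge_sup => [|_ [u ->]//]; case: supS.
  have : b v - `|z - iota v| <= phi z.
    by apply: ub_le_sup; [case: supS|exists v].
  rewrite ler_norml; lra.
have near (z : X) (e : R) : 0 < e -> exists v, `|z - iota v| < e.
  move=> e0; have nz : (ball z e : set X) !=set0 by exists z; exact: ballxx.
  have oz : open (ball z e : set X) by exact: ball_open.
  have [y [+ [v _ vy]]] := dX _ nz oz.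
  by rewrite -ball_normE /= -vy => zv; exists v.
have phi_lin (a : R) z w : phi (a *: z + w) = a * phi z + phi w.
  apply/eqP; rewrite -subr_eq0 -normr_le0; apply/ler_addgt0Pl => e e0; rewrite addr0.
  have a1 : 0 < `|a| + 1 by rewrite ltr_wpDl.
  have e4 : 0 < e / 4 by rewrite divr_gt0.
  have [u zu] := near z _ (divr_gt0 e4 a1).
  have [v wv] := near w _ e4.
  have h1 := phiP z u; have h2 := phiP w v; have h3 := phiP (a *: z + w) (a *: u + v).
  have azu : `|a * (phi z - b u)| <= e / 4 /\ `|a *: (z - iota u)| <= e / 4.
    rewrite normrM normrZ; suff : `|a| * `|z - iota u| <= e / 4.
      by split=> //; apply: le_trans H; rewrite ler_wpM2l.
    move: zu; rewrite ltr_pdivlMr // => zu; have := normr_ge0 (z - iota u); nra.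
  have h4 : `|a *: z + w - iota (a *: u + v)| <= `|a *: (z - iota u)| + `|w - iota v|.
    rewrite linearP opprD addrACA -scalerBr; exact: ler_normD.
  rewrite blin in h3.
  have -> : phi (a *: z + w) - (a * phi z + phi w) =
    (phi (a *: z + w) - (a * b u + b v)) - a * (phi z - b u) - (phi w - b v) by ring.
  case: azu => azu1 azu2.
  apply: le_trans (ler_normB _ _) _; apply: le_trans (lerD (ler_normB _ _) (lexx _)) _.
  lra.
pose phim := GRing.isLinear.Build R X R^o _ phi phi_lin.
pose phiL : {linear X -> R^o} := HB.pack phi phim.
exists phiL; split.
  apply: bounded_linear_continuous; apply/linear_boundedP.
  have phi_le z : `|phi z| <= `|z|.
    have b0 : b 0 = 0 by have := bB 0 0; rewrite !subrr.
    by have := phiP z 0; rewrite b0 subr0 linear0 subr0.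
  by exists 1; split => // r r1 z; apply: le_trans (phi_le z) _; rewrite ler_peMl // ltW.
move=> u; apply/eqP; rewrite -subr_eq0 -normr_le0.
by apply: le_trans (phiP _ u) _; rewrite subrr normr0.
Qed.

(** The pointwise ultralimit [b] of the [h n] is linear and dominated by the norm, so it extends
    continuously to [X]. Weak nullity puts [b (x n)] below [eps / 2] for late [n], and [U]-many
    [h k] are within [eps / 2] of [b] at [x n]. *)
Lemma ultra_weakly_null (X : normedModType R) (iota : {linear c00 R -> X})
    (x : nat -> c00 R) (U : set_system nat) (h : nat -> c00 R) (eps : R) :
  UltraFilter U -> dense (range iota) -> weakly_null (fun n => iota (x n)) ->
  (forall n u, `|pairing (h n) u| <= `|iota u|) -> 0 < eps ->
  exists N, forall n, (N <= n)%N -> U [set k | `|pairing (h k) (x n)| < eps].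
Proof.
move=> UU dX wx hN eps0.
have /choice[b bP] : forall u, exists l, forall e, 0 < e ->
    U [set n | `|pairing (h n) u - l| < e].
  by move=> u; exact: (ultra_limit UU (hN^~ u)).
have blin (a : R) u v : b (a *: u + v) = a * b u + b v.
  apply/eqP; rewrite -subr_eq0 -normr_le0; apply/ler_addgt0Pl => e e0; rewrite addr0.
  have a1 : 0 < `|a| + 1 by rewrite ltr_wpDl.
  have e4 : 0 < e / 4 by rewrite divr_gt0.
  have /filter_ex[n [/= h1 [h2 h3]]] :
      U ([set n | `|pairing (h n) (a *: u + v) - b (a *: u + v)| < e / 4] `&`
        ([set n | `|pairing (h n) u - b u| < e / 4 / (`|a| + 1)] `&`
         [set n | `|pairing (h n) v - b v| < e / 4])).
    apply: filterI; first exact: bP.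
    by apply: filterI; apply: bP => //; exact: divr_gt0.
  rewrite pairing_linearr in h1.
  have h4 : `|a * (pairing (h n) u - b u)| <= e / 4.
    rewrite normrM; move: h2; rewrite ltr_pdivlMr //.
    by have := normr_ge0 (pairing (h n) u - b u); nra.
  have -> : b (a *: u + v) - (a * b u + b v) =
    a * (pairing (h n) u - b u) - (a * pairing (h n) u + pairing (h n) v - b (a *: u + v)) +
    (pairing (h n) v - b v) by ring.
  apply: le_trans (ler_normD _ _) _; apply: le_trans (lerD (ler_normB _ _) (lexx _)) _.
  lra.
have bN u : `|b u| <= `|iota u|.
  apply/ler_addgt0Pl => e e0; have /filter_ex[n /= h1] := bP u e e0.
  have := hN n u; move: h1; rewrite distrC => h1 h2.
  have -> : b u = (b u - pairing (h n) u) + pairing (h n) u by ring.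
  by apply: le_trans (ler_normD _ _) _; lra.
have [phi [cphi phib]] := dense_linear_extension dX blin bN.
have /cvgrPdist_lt/(_ (eps / 2)) := wx phi cphi.
have eps2 : 0 < eps / 2 by rewrite divr_gt0.
move=> /(_ eps2)[N _ HN].
exists N => n Nn; have := HN n Nn; rewrite /= phib sub0r normrN => bn.
apply: filterS (bP (x n) _ eps2) => k /= hk.
have -> : pairing (h k) (x n) = (pairing (h k) (x n) - b (x n)) + b (x n) by ring.
by apply: le_lt_trans (ler_normD _ _) _; lra.
Qed.

End WeaklyNull.

(** * Special functionals *)
Section Special.
Context {R : realType}.
Variables (F : nat -> set (c00 R)) (Xi1 Xi2 : set nat) (sigma : seq (c00 R) -> nat).
Implicit Types (f g z : c00 R) (E I L : set nat) (s : nat -> c00 R).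

Local Notation special_seq := (special_seq F Xi1 sigma).
Local Notation special_functional := (special_functional F Xi1 sigma).
Local Notation disjoint_family := (disjoint_family F Xi1 sigma).
Local Notation F2 := (F2 F Xi1 sigma).
Local Notation JT_norm := (JT_norm F Xi1 sigma).

Lemma index_set_down I i j : index_set I -> (i <= j)%N -> I j -> I i.
Proof.
by move=> [->//|[d ->]] ij /= jd; exact: leq_trans ij jd.
Qed.

(** Only neighbours are assumed successive; the nonzero block in between supplies a coordinate [w]
    through which the order passes on. *)
Lemma block_lt I s : (forall i j, (i <= j)%N -> I j -> I i) ->
  (forall i, I i.+1 -> successive (s i) (s i.+1)) ->
  forall i j, (i < j)%N -> I j ->
  forall u v, supp (s i) u -> supp (s j) v -> (u < v)%N.
Proof.
move=> dI sI i; elim=> [//|j IH]; rewrite ltnS leq_eqVlt => /orP[/eqP ->|ij] Ij u v su sv.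
  by have [_ _] := sI _ Ij; apply.
have [sj0 _ sj] := sI _ Ij; have [w sw] := c00_neq0 sj0.
have uw : (u < w)%N by apply: IH su sw => //; exact: dI (leqnSn j) Ij.
by apply: ltn_trans uw _; exact: sj.
Qed.

Lemma special_lt I s i j u v : special_seq I s -> I j -> s i u != 0 -> s j v != 0 ->
  (i < j)%N -> (u < v)%N.
Proof.
move=> [iI _ sI _ _] Ij su sv ij.
by apply: (block_lt (fun _ _ => index_set_down iI) sI ij Ij).
Qed.

Lemma special_unique I s i j w : special_seq I s -> I i -> I j ->
  s i w != 0 -> s j w != 0 -> i = j.
Proof.
move=> sS Ii Ij si sj; case: (ltngtP i j) => // ij.
  by have := special_lt sS Ij si sj ij; rewrite ltnn.
by have := special_lt sS Ii sj si ij; rewrite ltnn.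
Qed.

Lemma special_sumE I s i w : special_seq I s -> I i -> s i w != 0 ->
  \sum_(j \in I) s j w = s i w.
Proof.
move=> sS Ii si; rewrite -(fsbig_widen [set i]) ?fsbig_set1 //.
  by move=> _ ->.
move=> j [Ij ji]; apply: contrapT => sj; apply: ji => /=.
by apply: (special_unique sS) (si) => //; exact/eqP.
Qed.

Lemma special_val I s E f i w : special_functional I s E f -> E w -> I i ->
  s i w != 0 -> f w = s i w.
Proof.
move=> [sS _ _ fE] Ew Ii si; rewrite fE mem_set //; exact: special_sumE.
Qed.

Lemma special_supp I s E f w : special_functional I s E f -> f w != 0 ->
  exists i, [/\ E w, I i, s i w != 0 & f w = s i w].
Proof.
move=> sf; have [sS _ _ fE] := sf; move=> fw.
have Ew : E w by move: fw; rewrite fE; case: ifPn; rewrite ?eqxx // inE.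
suff [i Ii si] : exists2 i, I i & s i w != 0.
  by exists i; split => //; exact: special_val sf Ew Ii si.
apply: contrapT => H; move: fw; rewrite fE mem_set // fsbig1 ?eqxx // => i Ii.
by have [//|si] := eqVneq (s i w) 0; case: H; exists i.
Qed.

Lemma special_exists I s E : special_seq I s -> nat_interval E -> finite_set E ->
  exists f, special_functional I s E f.
Proof.
move=> sS iE fE.
have fs : (fun n => if n \in E then \sum_(i \in I) s i n else 0) \in @fin_supp R.
  rewrite fin_suppE; apply/asboolP; apply: sub_finite_set fE => n.
  by rewrite /supp /=; case: ifPn; rewrite ?eqxx // inE.
by exists (C00 fs).
Qed.

Lemma special_restr I s E E' f : special_functional I s E f -> nat_interval E' ->
  special_functional I s (E `&` E') (restr E' f).
Proof.
move=> [sS iE fE fv] iE'; split => //.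
- move=> i j [Ei E'i] [Ej E'j] n inj; split; first exact: iE inj.
  exact: iE' inj.
- exact: finite_setIl.
- by move=> n; rewrite restrE fv in_setI andbC; case: (n \in E').
Qed.

Lemma special_trunc I s q : special_seq I s -> I q ->
  special_seq [set i | (i <= q)%N] s.
Proof.
move=> [iI sF sI s0 sc] Iq.
have dI i : (i <= q)%N -> I i by move=> iq; exact: index_set_down Iq.
split => //; first by right; exists q.
- by move=> i /dI/sF.
- by move=> i /dI/sI.
- by move=> i /dI/sc.
Qed.

(** The norm bounds values only from above; the absolute value comes from changing the sign of all
    [a k], which keeps the sum of squares. *)
Lemma F2_le (d : nat) (a : 'I_d -> rat) (g : 'I_d -> c00 R) (u : c00 R) (c : R) :
  (0 < d)%N -> \sum_k a k ^+ 2 <= 1 -> disjoint_family g ->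
  (JT_norm u <= c%:E)%E ->
  `|\sum_k ratr (a k) * pairing (g k) u| <= c.
Proof.
move=> d0 a1 dg uc.
have H (b : 'I_d -> rat) : \sum_k b k ^+ 2 <= 1 ->
    \sum_k ratr (b k) * pairing (g k) u <= c.
  move=> b1; rewrite -pairing_suml -lee_fin; apply: le_trans uc.
  apply: ereal_sup_ubound; exists (\sum_k ratr (b k) *: g k) => //.
  by right; exists d, b, g.
rewrite ler_norml H // andbT lerNl.
apply: le_trans (H (fun k => - a k) _).
  by rewrite -sumrN; apply: ler_sum => k _; rewrite rmorphN mulNr.
by under eq_bigr do rewrite sqrrN.
Qed.

Lemma special_le I s E f (u : c00 R) (c : R) : special_functional I s E f ->
  (JT_norm u <= c%:E)%E -> `|pairing f u| <= c.
Proof.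
move=> sf uc.
have := @F2_le 1 (fun=> 1) (fun=> f) u c isT _ _ uc.
rewrite !big_ord1 rmorph1 mul1r; apply; first by rewrite expr1n.
exists (fun=> I), (fun=> s), (fun=> E); split => // i j _ _ _.
by rewrite [i]ord1 [j]ord1.
Qed.

(** Injectivity of [sigma]: equal codes come from equal initial segments. Position 0 is excluded
    because its index is a minimum, not computed by [sigma]. *)
Lemma coding_history I s J t i j : coding F Xi1 Xi2 sigma ->
  special_seq I s -> special_seq J t -> I i -> J j -> (0 < i)%N -> (0 < j)%N ->
  ind_seq F sigma s i = ind_seq F sigma t j ->
  i = j /\ forall l, (l < i)%N -> s l = t l.
Proof.
move=> cs sS tS Ii Jj i0 j0.
have cod I' r p : special_seq I' r -> I' p -> (0 < p)%N ->
    coding_domain F (mkseq r p).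
  move=> [iI' rF rI _ _] I'p p0; have dI l := index_set_down (i:=l) iI'.
  split; rewrite ?size_mkseq //.
    move=> f /mapP[l]; rewrite mem_iota /= add0n => lp ->.
    by apply: rF; apply: dI I'p; exact: ltnW.
  move=> l lp; rewrite !nth_mkseq //; last exact: ltnW.
  by apply: rI; apply: dI I'p; exact: ltnW.
case: i i0 Ii => // i _ Ii; case: j j0 Jj => // j _ Jj.
rewrite /ind_seq => e.
have {}e : mkseq s i.+1 = mkseq t j.+1.
  by apply: (coding_inj cs) e; rewrite inE; [exact: cod Ii _|exact: cod Jj _].
have ij : i.+1 = j.+1 by move/(congr1 size): e; rewrite !size_mkseq.
split => // l li; have := congr1 (nth 0 ^~ l) e.
by rewrite !nth_mkseq // -ij.
Qed.

(* The first element of the sequence is kept away from y because only the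
   indices of the later ones are values of sigma, hence determine the past. *)
Definition witness (a : nat) (eps : R) (y : c00 R)
    (w : (set nat * (nat -> c00 R)) * (set nat * c00 R)) :=
  [/\ special_functional w.1.1 w.1.2 w.2.1 w.2.2,
      forall n, w.2.1 n -> (a <= n)%N,
      forall n, w.1.2 0%N n != 0 -> (n < a)%N &
      eps <= `|pairing w.2.2 y|].

Definition overlap (w w' : (set nat * (nat -> c00 R)) * (set nat * c00 R)) :=
  ind_functional F sigma w.1.1 w.1.2 w.2.1 `&`
  ind_functional F sigma w'.1.1 w'.1.2 w'.2.1 !=set0.

Lemma restr_neq0 E f : restr E f != 0 -> exists v, E v /\ f v != 0.
Proof.
move=> /c00_neq0[v]; rewrite restrE; case: ifPn; rewrite ?eqxx // inE => Ev fv.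
by exists v.
Qed.

(* H is the sum of the elements of s lying entirely below a. *)
Lemma witness_history a eps y I s E f : coding F Xi1 Xi2 sigma -> 0 < eps ->
  witness a eps y ((I, s), (E, f)) ->
  exists H, (forall u c, (JT_norm u <= c%:E)%E -> `|pairing H u| <= c) /\
  forall I' s' E' f', witness a eps y ((I', s'), (E', f')) ->
    overlap ((I', s'), (E', f')) ((I, s), (E, f)) ->
  forall E0 g z, special_functional I' s' E0 g ->
    (forall n, z n != 0 -> E0 n /\ (n < a)%N) ->
    (forall i, I' i -> forall p q, s' i p != 0 -> s' i q != 0 ->
       (exists w, z w != 0 /\ (p <= w)%N) -> (q < a)%N) ->
    pairing g z = pairing H z.
Proof.
move=> cs eps0 [/= sf Ea s0a fy].
have [sS _ _ _] := sf; have [iI sne _ _ _] := sS.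
have dI i j : (i <= j)%N -> I j -> I i by exact: index_set_down.
(* [q] will be the first position whose element reaches [a] or beyond; [H] sums the positions before
   it. *)
pose T i := `[< I i /\ exists v, (a <= v)%N /\ s i v != 0 >].
have exT : exists i, T i.
  have [] := @pairing_neq0 _ f y; first by rewrite -normr_gt0 (lt_le_trans eps0).
  move=> w [fw _]; have [i [Ew Ii si _]] := special_supp sf fw.
  by exists i; apply/asboolP; split => //; exists w; split => //; exact: Ea.
case: (ex_minnP exT) => q /asboolP[Iq [v0 [av0 sqv0]]] qmin.
have q0 : (0 < q)%N.
  rewrite lt0n; apply/eqP => q0; rewrite q0 in sqv0.
  by have := s0a _ sqv0; rewrite ltnNge av0.
have Iq1 : I q.-1 by apply: dI Iq; exact: leq_pred.
have iH : nat_interval [set n | (n < a)%N].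
  by move=> i j _ /= ja n /andP[_ nj]; exact: leq_ltn_trans nj ja.
have [H Hs] := special_exists (special_trunc sS Iq1) iH (finite_II a).
exists H; split; first by move=> u c; exact: special_le Hs.
move=> I' s' E' f' [/= sf' E'a s'0a _].
have [sS' _ _ _] := sf'; have [iI' _ _ _ _] := sS'.
have dI' i j : (i <= j)%N -> I' j -> I' i by exact: index_set_down.
move=> [_ [[i' [I'i' /restr_neq0[v' [Ev' sv']]] <-] [i [Ii /restr_neq0[v [Ev sv]]]]]] /= ii'.
(* The shared index belongs to elements meeting [[a, oo)], while the first element of either
   sequence ends below [a]. So both positions are positive and the code determines the past. *)
have i'0 : (0 < i')%N.
  rewrite lt0n; apply/eqP => i0; rewrite i0 in sv'.
  by have := s'0a _ sv'; rewrite ltnNge E'a.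
have i0 : (0 < i)%N.
  rewrite lt0n; apply/eqP => i0; rewrite i0 in sv.
  by have := s0a _ sv; rewrite ltnNge Ea.
have [eii' ss'] := coding_history cs sS sS' Ii I'i' i0 i'0 ii'.
subst i'.
have qi : (q <= i)%N by apply: qmin; apply/asboolP; split => //; exists v; split => //; exact: Ea.
(* [s'] reaches [a] at position [q] too: by the overlap itself if [q = i], and because the sequences
   agree there if [q < i]. *)
have [v1 [av1 sv1]] : exists v1, (a <= v1)%N /\ s' q v1 != 0.
  move: qi; rewrite leq_eqVlt => /orP[/eqP ->|qi]; first by exists v'; split => //; exact: E'a.
  by exists v0; rewrite -ss'.
have I'q : I' q by exact: dI' qi I'i'.
move=> E0 g z sg zE zs'; apply: eq_pairing => w zw; have [E0w wa] := zE _ zw.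
(* An element of [s'] nonzero at [w] has position below [q], where [s] and [s'] agree: position [q]
   would straddle from [z] to [v1], and later ones start after [v1]. If there is no such element,
   both values vanish. *)
have [[l [I'l sl]]|nl] := pselect (exists l, I' l /\ s' l w != 0).
  have lq : (l < q)%N.
    rewrite ltnNge leq_eqVlt; apply/negP => /orP[/eqP ql|ql].
      rewrite -ql in sl; suff : (v1 < a)%N by rewrite ltnNge av1.
      by apply: (zs' _ I'q _ _ sl sv1); exists w.
    have v1w := special_lt sS' I'l sv1 sl ql.
    by have := ltn_trans v1w wa; rewrite ltnNge av1.
  have li := leq_trans lq qi.
  rewrite (special_val sg E0w I'l sl) -(ss' _ li).
  rewrite (special_val Hs (i:=l)) //=; last by rewrite ss'.
  by rewrite -ltnS prednK.
transitivity (0 : R).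
  have [//|gw] := eqVneq (g w) 0.
  by have [l [_ I'l sl _]] := special_supp sg gw; case: nl; exists l.
have [//|Hw] := eqVneq (H w) 0.
have [l [_ /= lq sl _]] := special_supp Hs Hw.
have li : (l < i)%N by apply: leq_trans qi; rewrite -(prednK q0) ltnS.
case: nl; exists l; rewrite -(ss' _ li); split => //.
by apply: dI' I'i'; exact: ltnW.
Qed.

End Special.

(** * Linked pairs *)
Section Linked.
Context {R : realType}.
Variables (F : nat -> set (c00 R)) (Xi1 Xi2 : set nat) (sigma : seq (c00 R) -> nat).
Variables (X : normedModType R) (iota : {linear c00 R -> X}) (x : nat -> c00 R) (C : R).
Hypothesis codF : coding F Xi1 Xi2 sigma.
Hypothesis normE : forall z, (`|iota z|)%:E = JT_norm F Xi1 sigma z.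
Hypothesis denseX : dense (range iota).
Hypothesis x_wnull : weakly_null (fun n => iota (x n)).
Hypothesis x_block : block_sequence x.
Hypothesis x_le : forall n, (JT_norm F Xi1 sigma (x n) <= C%:E)%E.

Local Notation special_functional := (special_functional F Xi1 sigma).
Local Notation JT_norm := (JT_norm F Xi1 sigma).

(* No element of s straddles from x n to x n', so a special sequence sharing
   with s an index used on x n' agrees with s on x n. *)
Definition linked (eps : R) (n n' : nat) := exists I s E f,
  [/\ special_functional I s E f, forall w, x n w != 0 -> E w,
      eps <= `|pairing f (x n)|, eps <= `|pairing f (x n')| &
      forall i, I i -> forall p q, s i p != 0 -> s i q != 0 ->
        (exists w, x n w != 0 /\ (p <= w)%N) ->
        forall w', x n' w' != 0 -> (q < w')%N].

Lemma x_lt n n' u v : (n < n')%N -> x n u != 0 -> x n' v != 0 -> (u < v)%N.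
Proof.
move=> nn' xu xv; have dT i j : (i <= j)%N -> setT j -> setT i by [].
exact: (block_lt dT (fun i _ => x_block i) nn').
Qed.

Lemma x_neq0 n : exists w, x n w != 0.
Proof. by have [x0 _ _] := x_block n; exact: c00_neq0. Qed.

Lemma pairing_gt0 (eps : R) f z : 0 < eps -> eps <= `|pairing f z| ->
  exists w, f w != 0 /\ z w != 0.
Proof. by move=> e0 fz; apply: pairing_neq0; rewrite -normr_gt0 (lt_le_trans e0). Qed.

(* K ^ 2 disjoint witnesses, averaged with weights +-1/K, would give an element
   of F2 exceeding K * eps > C on y. *)
Lemma witness_dependent a (eps : R) y K : 0 < eps -> C < K%:R * eps ->
  (JT_norm y <= C%:E)%E ->
  ~ exists w, (forall i, (i < K ^ 2)%N -> witness F Xi1 sigma a eps y (w i)) /\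
    forall i j, (i < K ^ 2)%N -> (j < K ^ 2)%N -> i <> j ->
      ~ overlap F sigma (w i) (w j).
Proof.
move=> e0 CK yC [w [wP wD]].
have K0 : (0 < K)%N.
  rewrite lt0n; apply/eqP => K0; move: CK yC; rewrite K0 mul0r => C0 yC.
  have : 0 <= `|iota y| by [].
  by rewrite -lee_fin normE => /le_trans/(_ yC); rewrite lee_fin leNgt C0.
have Kr : (K%:R : R) != 0 by rewrite pnatr_eq0 -lt0n.
have Kq : (K%:R : rat) != 0 by rewrite pnatr_eq0 -lt0n.
pose g (k : 'I_(K ^ 2)) := (w k).2.2.
pose b (k : 'I_(K ^ 2)) : bool := pairing (g k) y < 0.
pose c k : rat := (-1) ^+ b k / K%:R.
have dg : disjoint_family F Xi1 sigma g.
  exists (fun k : 'I__ => (w k).1.1), (fun k : 'I__ => (w k).1.2), (fun k : 'I__ => (w k).2.1).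
  split; first by move=> k; have [] := wP k (ltn_ord k).
  move=> i j _ _ ij; apply: val_inj; apply: contrapT => nij.
  by apply: (wD i j _ _ nij).
have c1 : \sum_k c k ^+ 2 <= 1.
  rewrite (eq_bigr (fun=> (K%:R ^+ 2)^-1)); last first.
    by move=> k _; rewrite /c expr_div_n sqrr_sign mul1r.
  by rewrite sumr_const card_ord -(mulr_natl _ (K ^ 2)) natrX mulfV ?expf_neq0.
have := F2_le _ c1 dg yC; rewrite expn_gt0 K0 => /(_ isT).
apply/negP; rewrite -ltNge; apply: (lt_le_trans CK).
apply: le_trans (ler_norm _).
have -> : K%:R * eps = \sum_(k < K ^ 2) K%:R^-1 * eps :> R.
  by rewrite sumr_const card_ord -(mulr_natl _ (K ^ 2)) natrX; field.
apply: ler_sum => k _; have [_ _ _ gk] := wP k (ltn_ord k).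
rewrite /c rmorphM /= rmorphXn rmorphN1 fmorphV /= ratr_nat.
rewrite [leRHS]mulrAC [leRHS]mulrC ler_wpM2l ?invr_ge0 // -/(g k).
apply: le_trans gk _; rewrite /b; case: ltP => h.
  by rewrite ltr0_norm // expr1 mulN1r.
by rewrite ger0_norm // expr0 mul1r.
Qed.

(** Let [a] be the least point of the support of [x n']. A maximal non-overlapping family of
    witnesses on [x n'] has fewer than [K ^ 2] members, and the [h j] are their histories. The
    functional [f] of a linked pair, cut to [[a, oo)], is a witness and overlaps a member; hence [f]
    agrees on [x n] with the history of that member. *)
Lemma linked_cover (eps : R) K n' : 0 < eps -> C < K%:R * eps ->
  exists h : nat -> c00 R,
    (forall j u c, (JT_norm u <= c%:E)%E -> `|pairing (h j) u| <= c) /\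
    forall n, (n < n')%N -> linked eps n n' ->
      exists j, (j < K ^ 2)%N /\ eps <= `|pairing (h j) (x n)|.
Proof.
move=> e0 CK; case: (ex_minnP (x_neq0 n')) => a xa amin.
pose t0 : (set nat * (nat -> c00 R)) * (set nat * c00 R) :=
  ((setT, fun=> 0), (set0, 0)).
have [r [w [rK wP wmax]]] := maximal_independent t0
  (witness_dependent (a := a) e0 CK (x_le n')).
pose Hist j H := (forall u c, (JT_norm u <= c%:E)%E -> `|pairing H u| <= c) /\
  ((j < r)%N -> forall w', witness F Xi1 sigma a eps (x n') w' ->
    overlap F sigma w' (w j) ->
  forall E0 g (z : c00 R), special_functional w'.1.1 w'.1.2 E0 g ->
    (forall n, z n != 0 -> E0 n /\ (n < a)%N) ->
    (forall i, w'.1.1 i -> forall p q, w'.1.2 i p != 0 -> w'.1.2 i q != 0 ->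
       (exists v, z v != 0 /\ (p <= v)%N) -> (q < a)%N) ->
    pairing g z = pairing H z).
have /choice[h hP] : forall j, exists H, Hist j H.
  move=> j; have [jr|jr] := ltnP j r; last first.
    exists 0; split; last by rewrite ltnNge jr.
    move=> u c uc; rewrite pairing0r normr0 -lee_fin; apply: le_trans uc.
    by rewrite -normE lee_fin.
  have := wP j jr; case wjE: (w j) => [[I s] [E f]] wj.
  have [H [H1 H2]] := witness_history codF e0 wj.
  exists H; split => // _ [[I' s'] [E' f']] w' ov E0 g z.
  by rewrite wjE in ov; exact: H2 w' ov E0 g z.
exists h; split; first by move=> j; have [] := hP j.
move=> n nn' [I [s [E [f [sf xE fn fn' fs]]]]].
have iEa : nat_interval [set k | (a <= k)%N].
  by move=> i j /= ai _ k /andP[ik _]; exact: leq_trans ai ik.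
have sf' := special_restr sf iEa.
have [sS _ _ _] := sf; have [iI _ _ _ _] := sS.
pose w' : (set nat * (nat -> c00 R)) * (set nat * c00 R) :=
  ((I, s), (E `&` [set k | (a <= k)%N], restr [set k | (a <= k)%N] f)).
have fsa i : I i -> forall p q, s i p != 0 -> s i q != 0 ->
    (exists v, x n v != 0 /\ (p <= v)%N) -> (q < a)%N.
  by move=> Ii p q sp sq pv; exact: (fs i Ii p q sp sq pv).
have ww' : witness F Xi1 sigma a eps (x n') w'.
  split; [exact: sf'|by move=> k /= []| |].
    (* [f] is nonzero at some [v] in the support of [x n], so the first element of [s] has a
       coordinate at or before [v]; as no element straddles, it ends before [a]. *)
    move=> k /= sk; have [v [fv xv]] := pairing_gt0 e0 fn.
    have [i [_ Ii si _]] := special_supp sf fv.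
    case: i => [|i] in Ii si *; first by apply: (fsa 0%N Ii v k) => //; exists v.
    have kv := special_lt sS Ii sk si (ltn0Sn _).
    apply: (fsa 0%N _ k k) => //; first exact: index_set_down Ii.
    by exists v; split => //; exact: ltnW.
  rewrite /= (@eq_pairing _ _ f) // => k xk.
  by rewrite restrE mem_set //=; exact: amin.
have [j [jr ov]] := wmax w' ww'; exists j; split; first exact: ltn_trans rK.
have [_ /(_ jr w' ww') Hj] := hP j.
rewrite -(Hj _ E f (x n)) //.
  by case: ov => //; rewrite /overlap setIC.
by move=> k xk; split; [exact: xE|exact: x_lt xk xa].
Qed.

(** The functionals [h n' j] with [j < K ^ 2] detect every [n < n'] linked to [n']. For each [j]
    they are small on [x n] for [U]-many [n'] once [n] is late, and the finitely many [j] can be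
    treated at once. *)
Lemma ultra_not_linked (U : set_system nat) (eps : R) : UltraFilter U ->
  (forall N, U [set n | (N <= n)%N]) -> 0 < eps ->
  exists N, forall n, (N <= n)%N -> U [set n' | (n < n')%N /\ ~ linked eps n n'].
Proof.
move=> UU Uinf e0.
pose K := Num.bound `|C / eps|.
have CK : C < K%:R * eps.
  by rewrite -ltr_pdivrMr // (le_lt_trans (ler_norm _)) // archi_boundP.
have /choice[h hP] := fun n' => linked_cover n' e0 CK.
have /choice[N NP] : forall j, exists N, forall n, (N <= n)%N ->
    U [set n' | `|pairing (h n' j) (x n)| < eps].
  move=> j; apply: (ultra_weakly_null (h := h ^~ j) UU denseX x_wnull _ e0) => n' u.
  by have [+ _] := hP n'; apply; rewrite -normE.
exists (\max_(j < K ^ 2) N j) => n Nn.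
have Usmall : U [set n' | forall j, (j < K ^ 2)%N -> `|pairing (h n' j) (x n)| < eps].
  have : forall M, (M <= K ^ 2)%N ->
      U [set n' | forall j, (j < M)%N -> `|pairing (h n' j) (x n)| < eps].
    elim=> [_|M IH MK]; first exact: filterS filterT.
    have NM : (N M <= n)%N by apply: leq_trans Nn; exact: (leq_bigmax (Ordinal MK)).
    apply: filterS (filterI (IH (ltnW MK)) (NP M n NM)) => n' [/= h1 h2] j.
    by rewrite ltnS leq_eqVlt => /orP[/eqP ->//|/h1].
  exact.
apply: filterS (filterI (Uinf n.+1) Usmall) => n' [/= nn' h1]; split => // lk.
have [_ /(_ n nn' lk)[j [jK]]] := hP n'.
by rewrite leNgt h1.
Qed.

(** The outer terms [n1] and [n5] force [E] to cover what lies between. An element of [s] straddling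
    from [x n2] to [x n5] would act alone on [x n3] and [x n4] and be large on both, against
    separation. *)
Lemma linked_of_five (eps : R) M I s E f n1 n2 n3 n4 n5 : 0 < eps ->
  eps_separated F M eps x -> special_functional I s E f ->
  [/\ M n1, M n2, M n3, M n4 & M n5] ->
  [/\ eps <= `|pairing f (x n1)|, eps <= `|pairing f (x n2)|,
      eps <= `|pairing f (x n3)|, eps <= `|pairing f (x n4)| &
      eps <= `|pairing f (x n5)|] ->
  [/\ (n1 < n2)%N, (n2 < n3)%N, (n3 < n4)%N & (n4 < n5)%N] ->
  linked eps n2 n5.
Proof.
move=> e0 sepM sf [M1 M2 M3 M4 M5] [f1 f2 f3 f4 f5] [l12 l23 l34 l45].
have [sS iE _ _] := sf; have [iI sne _ _ _] := sS.
have [u1 [fu1 xu1]] := pairing_gt0 e0 f1; have [_ [Eu1 _ _ _]] := special_supp sf fu1.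
have [u5 [fu5 xu5]] := pairing_gt0 e0 f5; have [_ [Eu5 _ _ _]] := special_supp sf fu5.
have xE n : (n1 < n)%N -> (n < n5)%N -> forall w, x n w != 0 -> E w.
  move=> n1n nn5 w xw; apply: iE Eu1 Eu5 _ _; apply/andP; split; apply: ltnW.
    exact: x_lt n1n xu1 xw.
  exact: x_lt nn5 xw xu5.
have l13 := ltn_trans l12 l23; have l35 := ltn_trans l34 l45.
exists I, s, E, f; split => //; first exact: xE l12 (ltn_trans l23 l35).
move=> i Ii p q sp sq [w [xw pw]] w' xw'.
rewrite ltnNge; apply/negP => w'q.
have fsi n : (n2 < n)%N -> (n < n5)%N -> pairing f (x n) = pairing (s i) (x n).
  move=> n2n nn5; apply: eq_pairing => v xv.
  have wv := x_lt n2n xw xv; have vw' := x_lt nn5 xv xw'.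
  have pv := leq_ltn_trans pw wv; have vq := leq_trans vw' w'q.
  have Ev := xE n (ltn_trans l12 n2n) nn5 v xv.
  have [fv|fv] := eqVneq (f v) 0.
    rewrite fv; have [//|sv] := eqVneq (s i v) 0.
    by have := special_val sf Ev Ii sv; rewrite fv.
  have [j [_ Ij sj ->]] := special_supp sf fv.
  case: (ltngtP j i) => [ji|ij|-> //].
    by have := special_lt sS Ii sj sp ji; rewrite ltnNge ltnW.
  by have := special_lt sS Ij sq sj ij; rewrite ltnNge ltnW.
have [Fi _] := sne i Ii.
suff e34 : n3 = n4 by rewrite e34 ltnn in l34.
apply: (sepM _ Fi); split => //.
  by rewrite -fsi // (ltn_trans l34).
by rewrite -fsi // (ltn_trans l23).
Qed.

Lemma sparse_subset (L : set nat) (eps : R) : infinite_set L -> 0 < eps ->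
  (forall L (eps : R), infinite_set L -> 0 < eps ->
     exists M, [/\ M `<=` L, infinite_set M & eps_separated F M eps x]) ->
  exists M, [/\ M `<=` L, infinite_set M &
    forall I s E f, special_functional I s E f ->
    forall t : seq nat, uniq t ->
      (forall n, n \in t -> M n /\ eps <= `|pairing f (x n)|) ->
      (size t <= 4)%N].
Proof.
move=> iL e0 /(_ L eps iL e0)[L0 [L0L iL0 sepL0]].
(* The sets containing a tail of [L0]: an ultrafilter above [G] is free and contains [L0]. *)
pose G : set_system nat := [set A | exists N, forall n, L0 n -> (N <= n)%N -> A n].
have GF : ProperFilter G.
  split; first by move=> [N HN]; have [n [Nn L0n]] := infinite_unbounded N iL0; exact: HN n L0n Nn.
  split; first by exists 0%N.
    move=> A B [N HN] [N' HN']; exists (maxn N N') => n L0n.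
    by rewrite geq_max => /andP[Nn N'n]; split; [exact: HN|exact: HN'].
  by move=> A B AB [N HN]; exists N => n L0n Nn; apply/AB/HN.
have [U [UU GU]] := ultraFilterLemma GF.
have Uinf N : U [set n | (N <= n)%N] by apply: GU; exists N.
have UL0 : U L0 by apply: GU; exists 0%N.
have [N HN] := ultra_not_linked UU Uinf e0.
have [M [MP iM MD]] : exists M, [/\ M `<=` [set n | L0 n /\ (N <= n)%N],
    infinite_set M & forall i j, M i -> M j -> (i < j)%N -> ~ linked eps i j].
  apply: diagonal_subset => t tP.
  (* Each earlier [i] forbids only a [U]-small set of successors, so finitely many of them leave a
     common choice. *)
  have : U [set n | (L0 n /\ (N <= n)%N) /\ forall i, i \in t -> (i < n)%N /\ ~ linked eps i n].
    elim: t tP => [|i t IH] tP.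
      by apply: filterS (filterI UL0 (Uinf N)) => n [].
    have Ui : U [set n' | (i < n')%N /\ ~ linked eps i n'].
      by apply: HN; have [] := tP i (mem_head _ _).
    have {}IH := IH (fun j jt => tP j (mem_behead (s := i :: t) jt)).
    apply: filterS (filterI IH Ui) => n [/= [h1 h2] h3]; split => // j.
    by rewrite inE => /orP[/eqP ->//|/h2].
  by move=> /filter_ex[n /= h]; exists n.
exists M; split => //; first by move=> n /MP[/L0L].
move=> I s E f sf t ut tP; rewrite leqNgt; apply/negP => t5.
have st : sorted ltn (sort leq t).
  by rewrite ltn_sorted_uniq_leq sort_uniq ut (sort_sorted leq_total).
have {}tP n : n \in sort leq t -> M n /\ eps <= `|pairing f (x n)|.
  by rewrite mem_sort; exact: tP.
move: t5 st tP; rewrite -(size_sort leq).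
case: (sort leq t) => [|n1 [|n2 [|n3 [|n4 [|n5 t']]]]] //= _.
move=> /and5P[l12 l23 l34 l45 _] tP.
have [[M1 f1] [M2 f2] [M3 f3] [M4 f4] [M5 f5]] :
   [/\ M n1 /\ eps <= `|pairing f (x n1)|, M n2 /\ eps <= `|pairing f (x n2)|,
       M n3 /\ eps <= `|pairing f (x n3)|, M n4 /\ eps <= `|pairing f (x n4)| &
       M n5 /\ eps <= `|pairing f (x n5)|].
  by split; apply: tP; rewrite !inE eqxx ?orbT.
have l25 : (n2 < n5)%N by apply: ltn_trans l23 _; exact: ltn_trans l45.
have ML0 n : M n -> L0 n by move=> /MP[].
apply: (MD _ _ M2 M5 l25).
apply: (@linked_of_five eps L0 I s E f n1 n2 n3 n4 n5 e0 sepL0 sf) => //.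
by split; exact: ML0.
Qed.

End Linked.

(** * Tails of the sum of the tau_j *)
Section Tails.
Context {R : realType}.

Lemma finite_card_le (A : set nat) (r : R) :
  (forall t : seq nat, uniq t -> (forall n, n \in t -> A n) -> (size t)%:R <= r) ->
  finite_set A /\ (#|` fset_set A|)%:R <= r.
Proof.
move=> H; have fA : finite_set A.
  apply: contrapT => iA.
  have [B BA cB] := infinite_set_fset (Num.bound `|r|) iA.
  have := H B (fset_uniq B) (fun n nB => BA n nB); rewrite leNgt => /negP; apply.
  apply: le_lt_trans (ler_norm r) _; apply: lt_le_trans (archi_boundP (normr_ge0 r)) _.
  by rewrite ler_nat.
split=> //; apply: H; first exact: fset_uniq.
by move=> n; rewrite in_fset_set // inE.
Qed.

Lemma summable_tail (t : nat -> R) (c eta : R) : (forall j, 0 <= t j) ->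
  (forall N, \sum_(1 <= j < N) t j <= c) -> 0 < eta ->
  exists j, (0 < j)%N /\ forall N, \sum_(j <= i < N) t i <= eta.
Proof.
move=> t0 tc eta0.
pose S := [set r | exists n, r = \sum_(1 <= j < n.+1) t j].
have supS : has_sup S.
  by split; [exists (\sum_(1 <= j < 1) t j), 0%N|exists c => _ [n ->]].
have [_ [n ->] Sn] := sup_adherent eta0 supS.
exists n.+1; split => // N; have [Nn|nN] := leqP N n.+1.
  by rewrite big_geq // ltW.
have : \sum_(1 <= j < N) t j <= sup S.
  by apply: ub_le_sup; [case: supS|exists N.-1; case: N nN].
rewrite (big_cat_nat (n := n.+1)) //=; last exact: ltnW.
lra.
Qed.

Lemma supnorm_ge (f : c00 R) n : `|f n| <= supnorm f.
Proof.
have [->|fn] := eqVneq (f n) 0; first by rewrite normr0 bigmax_ge_id.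
have fsf : finite_set (supp f).
  by case: f {fn} => f /=; rewrite fin_suppE => /asboolP.
rewrite /supnorm; apply: (@le_bigmax_seq _ _ _ (fset_set (supp f)) 0 n xpredT
  (fun n : nat => `|f n|)) => //.
by rewrite in_fset_set // inE.
Qed.

(** Nonnegative terms with sum at most 1 are finite, so the tau_j can be replaced by reals [t j];
    the value 0 at [j = 0] is a default. *)
Lemma tau_summable (F : nat -> set (c00 R)) : JTG_family F ->
  exists t : nat -> R, [/\ forall j, 0 <= t j,
    forall j f n, (0 < j)%N -> F j f -> `|f n| <= t j &
    forall N, \sum_(1 <= j < N) t j <= 1].
Proof.
move=> FF.
have tau0 j : (0 < j)%N -> (0 <= tau F j)%E.
  move=> /(JTG_nonempty FF)[f fF]; apply: le_trans (_ : (supnorm f)%:E <= _)%E.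
    by rewrite lee_fin bigmax_ge_id.
  by apply: ereal_sup_ubound; exists f.
have sum1 N : (\sum_(1 <= j < N) tau F j <= 1)%E.
  apply: le_trans (JTG_tau_sum FF); apply: nneseries_lim_ge => j j1 _; exact: tau0.
have tauf j : (0 < j)%N -> tau F j \is a fin_num.
  move=> j0; rewrite ge0_fin_numE ?tau0 //; apply: le_lt_trans (ltry 1).
  apply: le_trans (sum1 j.+1); rewrite big_nat_recr //= leeDr //.
  by rewrite big_nat_cond sume_ge0 // => i /andP[/andP[i1 _] _]; exact: tau0.
exists (fun j => if (0 < j)%N then fine (tau F j) else 0); split.
- by move=> j; case: ifP => // j0; exact/fine_ge0/tau0.
- move=> j f n j0 fF; rewrite j0 -lee_fin fineK ?tauf //.
  apply: (@le_trans _ _ (supnorm f)%:E); first by rewrite lee_fin supnorm_ge.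
  by apply: ereal_sup_ubound; exists f.
move=> N; rewrite -lee_fin -sumEFin; apply: le_trans (sum1 N).
rewrite big_nat_cond [leRHS]big_nat_cond; apply: lee_sum => j /andP[/andP[j1 _] _].
by rewrite j1 fineK ?tauf.
Qed.

Lemma pow2_sum (j N : nat) : \sum_(j <= i < N) (2 ^+ i.+1)^-1 <= 1 :> R.
Proof.
apply: le_trans (_ : \sum_(0 <= i < N) (2 ^+ i.+1)^-1 <= 1).
  have p0 i : 0 <= (2 ^+ i.+1)^-1 :> R by rewrite invr_ge0 exprn_ge0.
  have [jN|Nj] := leqP j N; last by rewrite big_geq ?sumr_ge0 // ltnW.
  by rewrite [leRHS](big_cat_nat (n := j)) //= lerDr sumr_ge0.
suff -> : \sum_(0 <= i < N) (2 ^+ i.+1)^-1 = 1 - (2 ^+ N)^-1 :> R.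
  by rewrite lerBlDr lerDl invr_ge0 exprn_ge0.
elim: N => [|N IH]; first by rewrite big_geq // expr0 invr1 subrr.
rewrite big_nat_recr //= IH exprS; field.
by rewrite expf_neq0.
Qed.

End Tails.

(** * Square-sum and tail estimates for disjoint families *)

Section Counting.
Context {R : realType}.
Variables (F : nat -> set (c00 R)) (Xi1 Xi2 : set nat) (sigma : seq (c00 R) -> nat).
Local Notation special_functional := (special_functional F Xi1 sigma).
Local Notation JT_norm := (JT_norm F Xi1 sigma).

(** Homogeneity: dividing the [a k] by the square root of [A] would normalize them. Coefficients
    must be rational, so the argument is by contradiction, scaling by a rational [q] strictly
    between [C / |T|] and [1 / sqrt A], or just above [C / |T|] when [A = 0]. *)
Lemma disjoint_l2 (d : nat) (a : 'I_d -> rat) (g : 'I_d -> c00 R) (u : c00 R) (C : R) :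
  (0 < d)%N -> disjoint_family F Xi1 sigma g -> (JT_norm u <= C%:E)%E ->
  (\sum_k ratr (a k) * pairing (g k) u) ^+ 2 <= C ^+ 2 * \sum_k ratr (a k) ^+ 2.
Proof.
move=> d0 dg uC; set T := \sum_k _ * _.
have AE : \sum_k ratr (a k) ^+ 2 = ratr (\sum_k a k ^+ 2) :> R.
  by rewrite rmorph_sum; apply: eq_bigr => k _; rewrite rmorphXn.
set A := \sum_k _ ^+ 2 in AE *.
have A0 : 0 <= A by apply: sumr_ge0 => k _; exact: sqr_ge0.
have C0 : 0 <= C.
  apply: (le_trans (normr_ge0 _) (F2_le (a := fun=> 0) d0 _ dg uC)).
  by rewrite big1 // => k _; rewrite expr0n.
rewrite leNgt; apply/negP => AT.
have T0 : 0 < `|T|.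
  rewrite normr_gt0; apply: contraTneq AT => ->.
  by rewrite expr0n /= -leNgt mulr_ge0 // sqr_ge0.
have sA : Num.sqrt A ^+ 2 = A by rewrite sqr_sqrtr.
have s0 : 0 <= Num.sqrt A by exact: sqrtr_ge0.
have CsT : C * Num.sqrt A < `|T|.
  rewrite -(ltr_pXn2r (n := 2)) ?nnegrE ?mulr_ge0 //.
  by rewrite exprMn sA real_normK // num_real.
have [q] : exists q : rat, [/\ 0 <= ratr q :> R, C < ratr q * `|T| & ratr q * Num.sqrt A <= 1 :> R].
  have [s1|s1] := eqVneq (Num.sqrt A) 0.
    have C1 : C / `|T| < C / `|T| + 1 by rewrite ltrDl.
    have [q] := rat_in_itvoo C1; move=> /andP[]; rewrite !bnd_simp => q1 _; exists q.
    rewrite s1 mulr0 ler01 -ltr_pdivrMr //; split => //.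
    by apply: le_trans (ltW q1); rewrite divr_ge0.
  have sp : 0 < Num.sqrt A by rewrite lt_neqAle eq_sym s1.
  have C1 : C / `|T| < (Num.sqrt A)^-1.
    by rewrite ltr_pdivrMr // mulrC ltr_pdivlMr.
  have [q] := rat_in_itvoo C1; move=> /andP[]; rewrite !bnd_simp => q1 q2; exists q.
  rewrite -ltr_pdivrMr //; split => //; first by apply: le_trans (ltW q1); rewrite divr_ge0.
  by rewrite -ler_pdivlMr // div1r ltW.
move=> [q0 qT qs].
have q1 : \sum_k (q * a k) ^+ 2 <= 1.
  rewrite (eq_bigr (fun k => q ^+ 2 * a k ^+ 2)); last by move=> k _; rewrite exprMn.
  rewrite -mulr_sumr -(ler_rat R) rmorphM /= -AE rmorphXn rmorph1 -sA -exprMn.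
  by rewrite exprn_ile1 // mulr_ge0.
have := F2_le d0 q1 dg uC.
rewrite (eq_bigr (fun k => ratr q * (ratr (a k) * pairing (g k) u))); last first.
  by move=> k _; rewrite rmorphM mulrA.
by rewrite -mulr_sumr -/T normrM (ger0_norm q0) leNgt qT.
Qed.

(** At [w] the functional equals one element of [s], which lies in the family of its own index. The
    guard [0 < p] is there because a first element that also lies in [F 0] has index 0, where [t]
    gives no bound. *)
Lemma special_index (t : nat -> R) I s E f w :
  (forall j g n, (0 < j)%N -> F j g -> `|g n| <= t j) ->
  special_functional I s E f -> f w != 0 ->
  exists p, ind_functional F sigma I s E p /\ ((0 < p)%N -> `|f w| <= t p).
Proof.
move=> tF sf fw; have [i [Ew Ii si ->]] := special_supp sf fw.
have [[iI sne _ [l Xl Fl] sc] _ _ _] := sf.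
exists (ind_seq F sigma s i); split.
  exists i => //; split => //; apply/eqP => /(congr1 (fun g : c00 R => g w)).
  by rewrite restrE mem_set // c00_0E; apply/eqP.
suff : F (ind_seq F sigma s i) (s i) by move=> Fi p0; exact: tF p0 Fi.
case: i Ii {si Ew} => [_|i Ii]; last exact: sc.
rewrite /ind_seq /=; set P := [set j | _].
have [j Pj] : P !=set0.
  have exF : exists j, `[< F j (s 0%N) >] by exists l; exact/asboolP.
  case: (ex_minnP exF) => j /asboolP Fj jmin; exists j; split => // k Fk.
  exact/jmin/asboolP.
by case: xgetP => [_ -> []//|/(_ j)].
Qed.

(* Disjointness makes the indices used at a coordinate distinct, so the
   functionals with all indices >= j add up to at most a tail of sum tau_p. *)
Lemma late_sum (t : nat -> R) (d : nat) (g : 'I_d -> c00 R)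
    (I E : 'I_d -> set nat) (s : 'I_d -> nat -> c00 R) (Q : pred 'I_d)
    (j : nat) (eta : R) (u : c00 R) N :
  (forall i, 0 <= t i) ->
  (forall i f n, (0 < i)%N -> F i f -> `|f n| <= t i) -> (0 < j)%N ->
  (forall N, \sum_(j <= i < N) t i <= eta) ->
  (forall k, special_functional (I k) (s k) (E k) (g k)) ->
  trivIset setT (fun k => ind_functional F sigma (I k) (s k) (E k)) ->
  (forall k, Q k -> forall p, ind_functional F sigma (I k) (s k) (E k) p -> (j <= p)%N) ->
  (forall n, (N <= n)%N -> u n = 0) ->
  \sum_(k | Q k) `|pairing (g k) u| <= (\sum_(w < N) `|u w|) * eta.
Proof.
move=> t0 tF j0 teta gs tI Qj uN.
apply: (@le_trans _ _ (\sum_(k | Q k) \sum_(w < N) `|u w| * `|g k w|)).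
  apply: ler_sum => k _; rewrite (pairing_big _ uN).
  apply: le_trans (ler_norm_sum _ _ _) _; apply: ler_sum => w _.
  by rewrite normrM mulrC.
rewrite exchange_big mulr_suml; apply: ler_sum => w _ /=.
rewrite -mulr_sumr ler_wpM2l //.
have /choice[p pP] : forall k, exists p, g k w != 0 ->
    ind_functional F sigma (I k) (s k) (E k) p /\ ((0 < p)%N -> `|g k w| <= t p).
  move=> k; have [gk|gk] := eqVneq (g k w) 0; first by exists 0%N.
  by have [p pp] := special_index tF (gs k) gk; exists p.
apply: (@le_trans _ _ (\sum_(k | Q k && (g k w != 0)) t (p k))).
  rewrite (bigID (fun k => g k w != 0)) /= [X in _ + X]big1 ?addr0; last first.
    by move=> k /andP[_ /negPn/eqP ->]; rewrite normr0.
  apply: ler_sum => k /andP[Qk gk]; have [ip] := pP k gk; apply.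
  by apply: leq_trans j0 _; exact: Qj ip.
apply: (@sumr_inj_le R d p _ t j eta) => // [k l /andP[Qk gk] /andP[Ql gl] kl|k /andP[Qk gk]].
  apply: tI => //; exists (p k); split; first by have [] := pP k gk.
  by rewrite kl; have [] := pP l gl.
by apply: (Qj k Qk); have [] := pP k gk.
Qed.

End Counting.

(** * Counting *)
Section Count.
Context {R : realType}.
Variables (F : nat -> set (c00 R)) (Xi1 Xi2 : set nat) (sigma : seq (c00 R) -> nat).
Variables (x : nat -> c00 R) (C : R) (m : nat).
Hypothesis m_gt0 : (0 < m)%N.
Hypothesis x_block : block_sequence x.
Hypothesis x_le : forall n, (JT_norm F Xi1 sigma (x n) <= C%:E)%E.

Local Notation special_functional := (special_functional F Xi1 sigma).

(** [y] is plus or minus a coordinate and the [x n] have disjoint supports, so at most one [n]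
    counts; if one does, [1 / m <= C] and the right side exceeds 1. *)
Lemma F0_count (y : c00 R) (u : seq nat) : JTG_family F -> F 0%N y -> uniq u ->
  (forall n, n \in u -> m%:R^-1 <= `|pairing y (x n)|) ->
  (size u)%:R <= 66 * m%:R ^+ 2 * C ^+ 2.
Proof.
move=> FF F0y uu uP; have mR : 0 < m%:R :> R by rewrite ltr0n.
have pairN (f z : c00 R) : pairing (- f) z = - pairing f z.
  by rewrite -[- f]addr0 -scaleN1r pairing_linearl pairing0r addr0 mulN1r.
have [k yk] : exists k, forall z, `|pairing y z| = `|z k|.
  move: F0y; rewrite (JTG_0 FF) => -[k [->|->]]; exists k => z.
    by rewrite pairing_unit_vec.
  by rewrite pairN normrN pairing_unit_vec.
have yC n : `|pairing y (x n)| <= C.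
  have F0z z : F 0%N z -> pairing z (x n) <= C.
    move=> F0z; rewrite -lee_fin; apply: le_trans (x_le n).
    by apply: ereal_sup_ubound; exists z => //; left.
  rewrite ler_norml F0z // andbT lerNl -pairN F0z //.
  move: F0y; rewrite (JTG_0 FF) => -[j [->|->]]; exists j; first by right.
  by left; rewrite opprK.
have xk n : n \in u -> x n k != 0.
  by move=> /uP; rewrite yk -normr_gt0; apply: lt_le_trans; rewrite invr_gt0.
case: u uu uP xk => [|n [|n' u]] uu uP xk.
- by rewrite /= mulr_ge0 ?sqr_ge0 // mulr_ge0 ?sqr_ge0.
- have := le_trans (uP n (mem_head _ _)) (yC n).
  rewrite -[leLHS]mul1r ler_pdivrMr // => mC /=.
  have : 1 <= (C * m%:R) ^+ 2 by rewrite expr_ge1 // ltW // (lt_le_trans ltr01).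
  rewrite exprMn; have := sqr_ge0 C; have := sqr_ge0 (m%:R : R); nra.
- have xn := xk n (mem_head _ _); have xn' := xk n'.
  rewrite !inE eqxx orbT in xn'; have {}xn' := xn' isT.
  move: uu; rewrite /= inE negb_or => /andP[/andP[nn' _] _].
  case: (ltngtP n n') nn' => // h _.
    by have := x_lt x_block h xn xn'; rewrite ltnn.
  by have := x_lt x_block h xn' xn; rewrite ltnn.
Qed.

(** [N n] bounds the support of [x n], and [J n] is so late that disjoint functionals with all
    indices from [J n] on add up to at most [delta] on [x n]. Two errors [delta = 1 / (4 m)] leave
    [1 / (2 m)] out of [1 / m]. *)
Variables (t : nat -> R) (N J : nat -> nat) (L : set nat).
Local Notation delta := ((4 * m%:R)^-1 : R).
Hypothesis t_ge0 : forall j, 0 <= t j.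
Hypothesis t_le : forall j f n, (0 < j)%N -> F j f -> `|f n| <= t j.
Hypothesis NP : forall n k, (N n <= k)%N -> x n k = 0.
Hypothesis J_gt0 : forall n, (0 < J n)%N.
Hypothesis JP : forall n M,
  \sum_(J n <= i < M) t i <= delta / (\sum_(w < N n) `|x n w| + 1).
Hypothesis LP : forall b, L b -> forall I s E f, special_functional I s E f ->
  forall u : seq nat, uniq u ->
    (forall n, n \in u -> [/\ L n, (b < n)%N & delta / 2 ^+ J b <= `|pairing f (x n)|]) ->
    (size u <= 4)%N.

(* With m_k an index of g_k, b_k in L is chosen with m_k < J b_k, below every
   n in L such that m_k < J n; g_k matters on x_n only if n = b_k or
   |g_k(x_n)| >= delta / 2 ^ (J b_k), hence for at most five n. *)
Lemma combination_count (d : nat) (a : 'I_d -> rat) (g : 'I_d -> c00 R) (u : seq nat) :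
  (0 < d)%N -> \sum_k a k ^+ 2 <= 1 -> disjoint_family F Xi1 sigma g -> uniq u ->
  (forall n, n \in u ->
     L n /\ m%:R^-1 <= `|pairing (\sum_k ratr (a k) *: g k) (x n)|) ->
  (size u)%:R <= 66 * m%:R ^+ 2 * C ^+ 2.
Proof.
move=> d0 a1 dg uu uP; have [I [s [E [gs tI]]]] := dg.
have mR : 0 < m%:R :> R by rewrite ltr0n.
have delta0 : 0 < delta by rewrite invr_gt0 mulr_gt0.
pose ind k := ind_functional F sigma (I k) (s k) (E k).
(* A functional without indices vanishes and has no least index [mu k], so such [k] are set
   apart. *)
pose ne k := `[< ind k !=set0 >].
have g0 k z : ~~ ne k -> pairing (g k) z = 0.
  move=> nk; apply/eqP; apply: contraNT nk => /pairing_neq0[w [gw _]].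
  by have [p [ip _]] := special_index t_le (gs k) gw; apply/asboolP; exists p.
have /choice[mu muP] : forall k, exists j, ne k -> ind k j /\ forall p, ind k p -> (j <= p)%N.
  move=> k; have [/asboolP [p ip]|] := boolP (ne k); last by exists 0%N.
  have exI : exists p, `[< ind k p >] by exists p; apply/asboolP.
  case: (ex_minnP exI) => j /asboolP ij jmin; exists j => _; split => // q iq.
  exact/jmin/asboolP.
have /choice[b bP] : forall k, exists b, forall n, L n -> (mu k < J n)%N ->
    [/\ L b, (b <= n)%N & (mu k < J b)%N].
  move=> k; have [[n [Ln kn]]|H] := pselect (exists n, L n /\ (mu k < J n)%N); last first.
    by exists 0%N => n Ln kn; case: H; exists n.
  have exb : exists b, `[< L b /\ (mu k < J b)%N >] by exists n; apply/asboolP.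
  case: (ex_minnP exb) => b /asboolP[Lb kb] bmin; exists b => n' Ln' kn'.
  by split => //; apply: bmin; apply/asboolP.
pose S n k := (mu k < J n)%N && ((n == b k) || (delta / 2 ^+ J (b k) <= `|pairing (g k) (x n)|)).
have alpha1 k : `|ratr (a k) : R| <= 1.
  have ak : a k ^+ 2 <= 1.
    apply: le_trans a1; rewrite (bigD1 k) //= lerDl sumr_ge0 // => j _.
    exact: sqr_ge0.
  rewrite -(expr_le1 (n := 2)) // -normrX ger0_norm ?sqr_ge0 // -rmorphXn /=.
  by rewrite -(rmorph1 (@ratr R)) ler_rat.
have rest n : L n -> \sum_(k | ~~ S n k) `|pairing (g k) (x n)| <= 2 * delta.
  move=> Ln; rewrite (bigID ne) /= addrC big1 ?add0r; last first.
    by move=> k /andP[_ nk]; rewrite g0 // normr0.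
  (* The two errors: the [k] with [J n <= mu k] give a tail of the tau_j; for the others the value
     is below [delta / 2 ^ J (b k)], at most [delta / 2 ^ (mu k + 1)], and the [mu k] are distinct
     by disjointness. *)
  rewrite (bigID (fun k => J n <= mu k)%N) /= mulr_natl mulr2n; apply: lerD.
    apply: le_trans (late_sum (eta := delta / (\sum_(w < N n) `|x n w| + 1))
      t_ge0 t_le (J_gt0 n) (JP n) gs tI _ (NP (n := n))) _.
      move=> k /andP[/andP[_ nek] Jk] p ip; apply: leq_trans Jk _.
      by have [_] := muP k nek; apply.
    have l0 : 0 <= \sum_(w < N n) `|x n w| by apply: sumr_ge0.
    by rewrite mulrCA ler_piMr ?(ltW delta0) // ler_pdivrMr ?mul1r ?ltr_wpDl // lerDl.
  apply: (@le_trans _ _ (\sum_(k | ne k) delta * (2 ^+ (mu k).+1)^-1)).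
    rewrite [leRHS](bigID (fun k => ~~ S n k && ~~ (J n <= mu k)%N)) /=.
    rewrite -[leLHS]addr0; apply: lerD; last first.
      by apply: sumr_ge0 => k _; rewrite mulr_ge0 ?(ltW delta0) // invr_ge0.
    rewrite (eq_bigl (fun k => ne k && (~~ S n k && ~~ (J n <= mu k)%N))); last first.
      by move=> k /=; rewrite andbCA andbA.
    apply: ler_sum => k /andP[_ /andP[]]; rewrite /S -ltnNge => + kn.
    rewrite kn /= negb_or -ltNge => /andP[_ gk]; apply: le_trans (ltW gk) _.
    have [_ _ kb] := bP k n Ln kn.
    rewrite ler_wpM2l ?(ltW delta0) // lef_pV2 ?posrE ?exprn_gt0 //.
    by rewrite ler_weXn2l // ler1n.
  rewrite -mulr_sumr ler_piMr ?(ltW delta0) //.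
  apply: (@sumr_inj_le R d mu ne (fun i => (2 ^+ i.+1)^-1) 0%N 1) => //.
    by move=> M; exact: pow2_sum.
  move=> k l nek nel kl; apply: tI => //; exists (mu k); split.
    by have [] := muP k nek.
  by rewrite kl; have [] := muP l nel.
have C2 : 0 <= C ^+ 2 by exact: sqr_ge0.
have main n : n \in u -> (2 * m%:R)^-1 ^+ 2 <= C ^+ 2 * \sum_(k | S n k) (ratr (a k) : R) ^+ 2.
  move=> nu; have [Ln] := uP n nu; rewrite pairing_suml (bigID (S n)) /= => h1.
  (* Zeroing the coefficients that do not matter at [n] keeps the family [g], and the square
     estimate then involves only the [k] with [S n k]. *)
  pose a' k := if S n k then a k else 0.
  have := disjoint_l2 a' d0 dg (x_le n).
  have -> : \sum_k ratr (a' k) * pairing (g k) (x n) =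
      \sum_(k | S n k) ratr (a k) * pairing (g k) (x n).
    rewrite [RHS]big_mkcond; apply: eq_bigr => k _; rewrite /a'.
    by case: ifP => // _; rewrite rmorph0 mul0r.
  have -> : \sum_k (ratr (a' k) : R) ^+ 2 = \sum_(k | S n k) (ratr (a k) : R) ^+ 2.
    rewrite [RHS]big_mkcond; apply: eq_bigr => k _; rewrite /a'.
    by case: ifP => // _; rewrite rmorph0 expr0n.
  apply: le_trans; rewrite -[leRHS]real_normK ?num_real //.
  rewrite ler_sqr ?nnegrE ?invr_ge0 ?mulr_ge0 ?(ltW mR) //.
  have h2 := rest n Ln.
  have h3 : `|\sum_(k | ~~ S n k) ratr (a k) * pairing (g k) (x n)| <= 2 * delta.
    apply: le_trans h2; apply: le_trans (ler_norm_sum _ _ _) _; apply: ler_sum => k _.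
    by rewrite normrM ler_piMl.
  have h4 := le_trans h1 (ler_normD _ _).
  have -> : (2 * m%:R)^-1 = m%:R^-1 - 2 * delta :> R by field; rewrite gt_eqF.
  lra.
have Scount k : (count (S ^~ k) u <= 5)%N.
  have [->//|] := eqVneq (count (S ^~ k) u) 0%N; rewrite -lt0n -has_count.
  move=> /hasP[n0 n0u /andP[kn0 _]]; have [Ln0 _] := uP n0 n0u.
  have [Lb _ _] := bP k n0 Ln0 kn0.
  (* [b k] is counted apart because [LP] speaks only of [n] beyond [b k]: one plus four. *)
  pose u' := [seq n <- u | S n k && (n != b k)].
  have u'4 : (size u' <= 4)%N.
    apply: (LP Lb (gs k)); first exact: filter_uniq.
    move=> n; rewrite mem_filter => /andP[/andP[/andP[kn /orP[-> //|gk]] nb] nu].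
    have [Ln _] := uP n nu; have [_ bn _] := bP k n Ln kn; split => //.
    by rewrite ltn_neqAle eq_sym nb.
  have Sb : subpred (S ^~ k) (predU (pred1 (b k)) (fun n => S n k && (n != b k))).
    by move=> n /= ->; case: eqVneq.
  apply: leq_trans (sub_count Sb u) _.
  apply: leq_trans (leq_addr (count (predI (pred1 (b k)) (fun n => S n k && (n != b k))) u) _) _.
  rewrite count_predUI count_uniq_mem // -size_filter -/u'.
  by rewrite (leq_add (leq_b1 _) u'4).
(* After exchanging the sums each squared coefficient occurs at most five times. *)
have total : \sum_(n <- u) (2 * m%:R)^-1 ^+ 2 <= 5 * C ^+ 2.
  apply: (@le_trans _ _ (\sum_(n <- u) C ^+ 2 * \sum_(k | S n k) (ratr (a k) : R) ^+ 2)).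
    by rewrite big_seq [leRHS]big_seq; apply: ler_sum.
  rewrite -mulr_sumr mulrC ler_wpM2r //.
  rewrite (exchange_big_dep predT) //=.
  apply: (@le_trans _ _ (\sum_k 5 * (ratr (a k) : R) ^+ 2)).
    apply: ler_sum => k _; rewrite big_const_seq iter_addr_0 -[leLHS]mulr_natl.
    by rewrite ler_wpM2r ?sqr_ge0 // ler_nat.
  rewrite -mulr_sumr ler_piMr //.
  have -> : \sum_k (ratr (a k) : R) ^+ 2 = ratr (\sum_k a k ^+ 2).
    by rewrite rmorph_sum; apply: eq_bigr => k _; rewrite rmorphXn.
  by rewrite -(rmorph1 (@ratr R)) ler_rat.
(* Each [n] contributes [1 / (4 m ^ 2)], so the size is at most [20 m ^ 2 C ^ 2], within the stated
   bound. *)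
move: total; rewrite big_const_seq count_predT iter_addr_0 -[leLHS]mulr_natl exprVn.
rewrite ler_pdivrMr ?exprn_gt0 ?mulr_gt0 // exprMn => h.
by apply: le_trans h _; have := sqr_ge0 (m%:R : R); nra.
Qed.

End Count.

(** * Diagonalization over the thresholds and conclusion *)

Theorem proposition3p14 (R : realType) (F : nat -> set (c00 R))
    (Xi1 Xi2 : set nat) (sigma : seq (c00 R) -> nat)
    (X : completeNormedModType R) (iota : {linear c00 R -> X})
    (x : nat -> c00 R) (C : R) :
  JTG_family F ->
  coding F Xi1 Xi2 sigma ->
  JT_completion F Xi1 sigma iota ->
  weakly_null (fun n => iota (x n)) ->
  separated_seq F Xi1 sigma x ->
  (forall n, (JT_norm F Xi1 sigma (x n) <= C%:E)%E) ->
  forall m : nat, (0 < m)%N ->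
  exists L : set nat, infinite_set L /\
    forall y, F2 F Xi1 sigma y ->
      let A := [set n | L n /\ m%:R^-1 <= `|pairing y (x n)|] in
      finite_set A /\
      (#|` fset_set A|)%:R <= 66 * m%:R ^+ 2 * C ^+ 2.
Proof.
move=> FF cs [normE denseX] wx [_ xb xsep] xC m m0.
have [t [t0 tF t1]] := tau_summable FF.
have /choice[N NP] : forall n, exists N, forall k, (N <= k)%N -> x n k = 0.
  by move=> n; exact: c00_bound.
have mR : 0 < m%:R :> R by rewrite ltr0n.
have delta0 : 0 < (4 * m%:R)^-1 :> R by rewrite invr_gt0 mulr_gt0.
(* The tail is measured against the l1 norm of [x n]; the added 1 keeps the denominator positive. *)
have /choice[J JP] : forall n, exists j, (0 < j)%N /\ forall M,
    \sum_(j <= i < M) t i <= (4 * m%:R)^-1 / (\sum_(w < N n) `|x n w| + 1).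
  move=> n; apply: summable_tail t0 t1 _; apply: divr_gt0 => //.
  by rewrite ltr_wpDl // sumr_ge0.
(* For an index [p < J n] this threshold is at most [delta / 2 ^ (p + 1)], with [delta = 1 / (4 m)],
   which makes neglected values summable over distinct [p]. *)
pose eps n : R := (4 * m%:R)^-1 / 2 ^+ J n.
have eps0 n : 0 < eps n by rewrite divr_gt0 // exprn_gt0.
pose sparse (A : set nat) n M := [/\ M `<=` A, infinite_set M &
  forall I s E f, special_functional F Xi1 sigma I s E f ->
    forall u : seq nat, uniq u ->
      (forall k, k \in u -> M k /\ eps n <= `|pairing f (x k)|) -> (size u <= 4)%N].
have /choice[nxt nxtP] : forall An : set nat * nat, exists M,
    infinite_set An.1 -> sparse An.1 An.2 M.
  move=> [A n]; have [iA|] := pselect (infinite_set A); last by exists set0.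
  by have [M MP] := sparse_subset cs normE denseX wx xb xC iA (eps0 n) xsep; exists M.
pose M := fix M n := if n is n'.+1 then nxt (M n', n') else setT.
have Minf n : infinite_set (M n).
  elim: n => [|n IH] /=; first exact: infinite_nat.
  by have [] := nxtP (M n, n) IH.
have MS n : sparse (M n) n (M n.+1) by exact: nxtP (M n, n) (Minf n).
have Mdecr i j : (i <= j)%N -> M j `<=` M i.
  elim: j => [|j IH]; first by rewrite leqn0 => /eqP ->.
  rewrite leq_eqVlt => /orP[/eqP -> //|ij].
  by have [MM _ _] := MS j; apply: subset_trans MM _; exact: IH.
(* Stages are numbered by the elements themselves: whatever follows [b] in [L] lies in [M b.+1], so
   [L] beyond [b] is sparse at threshold [eps b]. *)
have [L [_ iL LD]] : exists L, [/\ L `<=` setT, infinite_set L &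
    forall i j, L i -> L j -> (i < j)%N -> M i.+1 j].
  apply: diagonal_subset => u _.
  pose K := (\max_(i <- u) i).+1.
  have [n [Kn Mn]] := infinite_unbounded K (Minf K).
  exists n; split => // i iu.
  have iK : (i < K)%N by rewrite ltnS (leq_bigmax_seq (F := fun i => i) i).
  by split; [exact: leq_trans iK Kn|exact: Mdecr iK _ Mn].
exists L; split => // y yF2 A; apply: finite_card_le => u uu uA.
case: yF2 => [F0y|[d [a [g [d0 a1 dg yE]]]]].
  by apply: (F0_count m0 xb xC FF F0y uu) => n /uA[].
apply: (combination_count (L := L) m0 xC t0 tF NP (fun n => (JP n).1)
  (fun n => (JP n).2) _ d0 a1 dg uu); last by move=> n /uA[]; rewrite yE.
move=> b Lb I s E f sf v uv vP; have [_ _ sp] := MS b.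
by apply: (sp _ _ _ _ sf v uv) => n /vP[Ln bn fn]; split => //; exact: LD.
Qed.
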